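(* Let $M$ be a separable $\mathrm{II}_1$ factor. For each $t>0$, $$\mathcal G(M_t)=t^{-2}\,\mathcal G(M).$$
   Context: For a $\mathrm{II}_1$ factor $M$ with its faithful normal trace $\tau$, $\tau(1)=1$, let $\mathcal P(M)$ be the collection of all finite sets of mutually orthogonal projections in $M$ which sum to $1$. For $x\in M$ and $P\in\mathcal P(M)$ put $\mathcal I(x;P)=\sum_{p,q\in P,\ pxq\neq 0}\tau(p)\tau(q)$. For a finite subset $X\subset M$ put $\mathcal I(X;P)=\sum_{x\in X}\mathcal I(x;P)$ and $\mathcal I(X)=\inf_{P\in\mathcal P(M)}\mathcal I(X;P)$. $W^*(X)$ denotes the von Neumann algebra generated by $X$ (not automatically assumed to contain the identity of $M$). The generator invariant is $\mathcal G(M)=\inf\{\mathcal I(X): X\subset M\text{ finite},\ W^*(X)=M\}$, with $\mathcal G(M)=\infty$ if $M$ is not finitely generated. For $t>0$, the amplification $M_t$ is the $\mathrm{II}_1$ factor $p(\mathbb M_n(\mathbb C)\otimes M)p$, where $n$ is any integer greater than $t$ and $p\in\mathbb M_n(\mathbb C)\otimes M$ is a projection of normalised trace $t/n$; up to isomorphism it depends only on $M$ and $t$ (for $0<t<1$ one may take $pMp$ with $p\in M$ a projection, $\tau(p)=t$). The invariant $\mathcal G(M_t)$ is computed with the normalised trace of $M_t$. *)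

(* Defs.v *)
From HB Require Import structures.
From mathcomp Require Import all_boot all_order all_algebra finmap.
From mathcomp Require Import complex.
From mathcomp Require Import all_classical all_reals all_analysis.

Set Implicit Arguments.
Unset Strict Implicit.
Unset Printing Implicit Defensive.

Import Order.TTheory GRing.Theory Num.Theory.

Local Open Scope classical_set_scope.
Local Open Scope ring_scope.
Local Open Scope complex_scope.

Section DotNorm.
Variables (R : realType) (V : lmodType R[i]).

Definition dot_norm (d : V -> V -> R[i]) (x : V) : R :=
  Num.sqrt (complex.Re (d x x)).

Definition dot_complete (d : V -> V -> R[i]) : Prop :=
  forall u : nat -> V,
    (forall e : R, 0 < e -> exists N : nat, forall m n : nat,
      (N <= m)%N -> (N <= n)%N -> dot_norm d (u m - u n) < e) ->
    exists l : V, forall e : R, 0 < e -> exists N : nat, forall n : nat,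
      (N <= n)%N -> dot_norm d (u n - l) < e.

End DotNorm.

(* The inner product is linear in its first argument. *)
Record hilbertSpace (R : realType) := HilbertSpace {
  hilbert_sort :> lmodType R[i];
  hilbert_dot : {dot hilbert_sort for Num.conj};
  hilbert_complete : dot_complete hilbert_dot
}.

Definition hdot (R : realType) (H : hilbertSpace R) (x y : H) : R[i] :=
  hilbert_dot H x y.

Definition hnorm (R : realType) (H : hilbertSpace R) (x : H) : R :=
  dot_norm (@hdot R H) x.

(* The Hilbert space direct sum of n copies of H. *)
Section HilbertPower.
Variables (R : realType) (H : hilbertSpace R) (n : nat).

Definition power_dot (x y : {ffun 'I_n -> H}) : R[i] :=
  \sum_(i < n) hdot (x i) (y i).

Let power_dot_bilinear :
  bilinear_for *%R (Num.conj \; *%R) power_dot.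
Proof.
split=> [y a x1 x2|x a y1 y2]; rewrite /power_dot /= mulr_sumr -big_split /=;
  apply: eq_bigr => i _; rewrite !ffunE /hdot.
  by rewrite linearPl.
by rewrite linearPr.
Qed.

HB.instance Definition _ :=
  bilinear_isBilinear.Build R[i] {ffun 'I_n -> H} {ffun 'I_n -> H} R[i]
    *%R (Num.conj \; *%R) power_dot power_dot_bilinear.

Let power_dot_hermitian x y :
  power_dot x y = (-1) ^+ false * Num.conj (power_dot y x).
Proof.
rewrite expr0 mul1r /power_dot rmorph_sum /=; apply: eq_bigr => i _.
by rewrite /hdot hermC expr0 mul1r.
Qed.

HB.instance Definition _ :=
  isHermitianSesquilinear.Build R[i] {ffun 'I_n -> H} false Num.conj power_dot
    power_dot_hermitian.

Let power_dot_gt0 x : x != 0 -> 0 < power_dot x x.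
Proof.
move=> x0; have /existsP[i xi0] : [exists i, x i != 0].
  apply: contraNT x0; rewrite negb_exists => /forallP x0.
  by apply/eqP/ffunP => i; rewrite ffunE; apply/eqP; move: (x0 i); rewrite negbK.
rewrite /power_dot (bigD1 i)//= ltr_wpDr ?neq0_dnorm_gt0//.
by apply: sumr_ge0 => j _; exact: dnorm_ge0.
Qed.

HB.instance Definition _ :=
  isDotProduct.Build R[i] {ffun 'I_n -> H} power_dot power_dot_gt0.

Let hdotE (x : H) : hdot x x = (hnorm x ^+ 2)%:C.
Proof.
have x0 : 0 <= hdot x x by exact: dnorm_ge0.
have Rx : (complex.Re (hdot x x))%:C = hdot x x by rewrite RRe_real// ger0_real.
by rewrite /hnorm /dot_norm sqr_sqrtr ?Rx// -ler0c Rx.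
Qed.

Let power_normE (x : {ffun 'I_n -> H}) :
  dot_norm power_dot x = Num.sqrt (\sum_(i < n) hnorm (x i) ^+ 2).
Proof.
rewrite /dot_norm /power_dot; congr Num.sqrt.
by under eq_bigr do rewrite hdotE; rewrite -rmorph_sum.
Qed.

Let power_dot_complete : dot_complete power_dot.
Proof.
move=> u uC.
have /choice[l lP] : forall i, exists l : H, forall e : R, 0 < e ->
    exists N : nat, forall k, (N <= k)%N -> hnorm (u k i - l) < e.
  move=> i; apply: (hilbert_complete (u := fun k => u k i)) => e /uC[N NP].
  exists N => m k Nm Nk; apply: le_lt_trans (NP _ _ Nm Nk).
  rewrite power_normE -[leLHS]ger0_norm ?sqrtr_ge0// -sqrtr_sqr.
  apply: ler_wsqrtr; rewrite (bigD1 i)//= !ffunE lerDl.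
  by apply: sumr_ge0 => j _; exact: sqr_ge0.
exists [ffun i => l i] => e e0.
have d0 : 0 < e / n.+1%:R by rewrite divr_gt0.
have [N NP] := choice (fun i => lP i _ d0).
exists (\max_(i < n) N i)%N => k Nk; rewrite power_normE.
rewrite -[ltRHS]gtr0_norm// -sqrtr_sqr ltr_sqrt ?exprn_gt0//.
apply: (@le_lt_trans _ _ (\sum_(i < n) (e / n.+1%:R) ^+ 2)).
  apply: ler_sum => i _; rewrite !ffunE ler_pXn2r ?nnegrE ?sqrtr_ge0//.
    by apply/ltW/NP/(leq_trans _ Nk)/leq_bigmax.
  exact: ltW.
rewrite sumr_const card_ord -[ltLHS]mulr_natr expr_div_n -mulrA gtr_pMr ?exprn_gt0//.
rewrite mulrC ltr_pdivrMr ?exprn_gt0// mul1r -natrX ltr_nat.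
by rewrite expnS expn1 mulSn ltnS leq_addr.
Qed.

Definition hilbert_power : hilbertSpace R :=
  @HilbertSpace R {ffun 'I_n -> H} power_dot power_dot_complete.

End HilbertPower.

Section Operators.
Variables (R : realType) (H : hilbertSpace R).
Implicit Types (f g p : H -> H) (A D : set (H -> H)).

Definition bounded_operator f : Prop :=
  linear f /\ exists k : R, forall x : H, hnorm (f x) <= k * hnorm x.

Definition is_adjoint f g : Prop := forall x y : H, hdot (f x) y = hdot x (g y).

Definition is_projection p : Prop := p \o p = p /\ is_adjoint p p.

Definition positive_operator f : Prop := forall x : H, 0 <= hdot (f x) x.

Definition operator_le f g : Prop := positive_operator (g - f).

Definition wot_closure A : set (H -> H) :=
  [set f | bounded_operator f /\
    forall (s : seq (H * H)) (e : R), 0 < e ->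
      exists2 g, A g & forall x y : H, (x, y) \in s ->
        `|hdot ((f - g) x) y| < e%:C].

(* A von Neumann algebra on H need not contain the identity operator of H. *)
Record von_neumann_algebra A : Prop := {
  vna_bounded : A `<=` bounded_operator;
  vna_zero : A 0;
  vna_linear : forall (a : R[i]) f g, A f -> A g -> A (a *: f + g);
  vna_mul : forall f g, A f -> A g -> A (f \o g);
  vna_adjoint : forall f, A f -> exists2 g, A g & is_adjoint f g;
  vna_closed : wot_closure A `<=` A
}.

Definition generated_vna (X : set (H -> H)) : set (H -> H) :=
  [set f | forall A, von_neumann_algebra A -> X `<=` A -> A f].

Definition is_factor A : Prop :=
  [/\ von_neumann_algebra A, A idfun, (idfun : H -> H) <> 0 &
    forall f, A f -> (forall g, A g -> f \o g = g \o f) ->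
      exists a : R[i], f = a *: (idfun : H -> H)].

(* In a factor the nonzero abelian projections are the minimal ones. *)
Definition minimal_projection A p : Prop :=
  [/\ A p, is_projection p, p <> 0 &
    forall q, A q -> is_projection q -> operator_le q p -> q = 0 \/ q = p].

Definition II1_factor A : Prop :=
  [/\ is_factor A,
    forall v w, A v -> A w -> is_adjoint v w -> w \o v = idfun ->
      v \o w = idfun &
    forall p, ~ minimal_projection A p].

Definition operator_lub A D f : Prop :=
  [/\ A f, forall d, D d -> operator_le d f &
    forall g, A g -> (forall d, D d -> operator_le d g) -> operator_le f g].

Definition upward_directed D : Prop :=
  D !=set0 /\ forall d1 d2, D d1 -> D d2 ->
    exists d, [/\ D d, operator_le d1 d & operator_le d2 d].

Definition normal_functional A (tau : (H -> H) -> R[i]) : Prop :=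
  forall D f, D `<=` A -> D `<=` positive_operator -> upward_directed D ->
    operator_lub A D f ->
    complex.Re (tau f) = sup [set complex.Re (tau d) | d in D].

(* Only the values of tau on A matter. *)
Record normal_trace A (tau : (H -> H) -> R[i]) : Prop := {
  trace_linear : forall (a : R[i]) f g, A f -> A g ->
    tau (a *: f + g) = a * tau f + tau g;
  trace_tracial : forall f g, A f -> A g -> tau (f \o g) = tau (g \o f);
  trace_positive : forall f, A f -> positive_operator f -> 0 <= tau f;
  trace_faithful : forall f, A f -> positive_operator f -> tau f = 0 -> f = 0;
  trace_normal : normal_functional A tau;
  trace_unit : tau idfun = 1
}.

(* Separability of A in the norm x |-> tau (x^* x) ^ (1/2); for a II_1 factor
   this is separability of the predual, whatever the size of H. *)
Definition trace_separable A (tau : (H -> H) -> R[i]) : Prop :=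
  exists u : nat -> (H -> H), (forall k, A (u k)) /\
    forall f, A f -> forall e : R, 0 < e -> exists k g,
      is_adjoint (f - u k) g /\
      Num.sqrt (complex.Re (tau (g \o (f - u k)))) < e.

(* In the next definitions e is the unit of A, which may differ from the
   identity of H, and tau is the normalised trace of A. *)
Definition projection_partition A (e : H -> H) (P : {fset (H -> H)}) : Prop :=
  [/\ forall p, p \in P -> A p /\ is_projection p,
      forall p q, p \in P -> q \in P -> p <> q -> p \o q = 0 &
      \sum_(p <- P) p = e].

Definition calI_elt (tau : (H -> H) -> R[i]) (x : H -> H)
    (P : {fset (H -> H)}) : R :=
  \sum_(p <- P) \sum_(q <- P | p \o x \o q != 0)
    complex.Re (tau p) * complex.Re (tau q).

Definition calI_part (tau : (H -> H) -> R[i]) (X P : {fset (H -> H)}) : R :=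
  \sum_(x <- X) calI_elt tau x P.

Definition calI A (e : H -> H) (tau : (H -> H) -> R[i])
    (X : {fset (H -> H)}) : \bar R :=
  ereal_inf [set (calI_part tau X P)%:E | P in projection_partition A e].

(* The infimum of the empty set is +oo. *)
Definition calG A (e : H -> H) (tau : (H -> H) -> R[i]) : \bar R :=
  ereal_inf [set calI A e tau X | X in
    [set X : {fset (H -> H)} | [set` X] `<=` A /\ generated_vna [set` X] = A]].

Definition corner A p : set (H -> H) := [set p \o f \o p | f in A].

End Operators.

Section Amplification.
Variables (R : realType) (H : hilbertSpace R) (n : nat).

Definition matrix_operator (a : 'M[H -> H]_n) :
    hilbert_power H n -> hilbert_power H n :=
  fun x : {ffun 'I_n -> H} => [ffun i => \sum_(j < n) a i j (x j)].

(* The tensor product of the n x n complex matrices with A. *)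
Definition matrix_algebra (A : set (H -> H)) :
    set (hilbert_power H n -> hilbert_power H n) :=
  [set matrix_operator a | a in [set a : 'M[H -> H]_n | forall i j, A (a i j)]].

Definition matrix_entry (f : hilbert_power H n -> hilbert_power H n)
    (i j : 'I_n) : H -> H :=
  fun y => (f [ffun k => if k == j then y else 0] : {ffun 'I_n -> H}) i.

Definition matrix_trace (tau : (H -> H) -> R[i])
    (f : hilbert_power H n -> hilbert_power H n) : R[i] :=
  n%:R^-1 * \sum_(i < n) tau (matrix_entry f i i).

(* The normalised trace of the corner of the matrix algebra cut out by p. *)
Definition corner_trace (tau : (H -> H) -> R[i])
    (p f : hilbert_power H n -> hilbert_power H n) : R[i] :=
  matrix_trace tau f / matrix_trace tau p.

End Amplification.

(* Main.v *)
(** Both [M] and [p (M_n(C) (x) M) p] are corners of the factor [L = M_n(C) (x) M], so it is enough to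
    compare two corners [e L e] and [f L f] of [L], for an unnormalised trace [T], and to show
    [T(f)^2 G(f L f) <= T(e)^2 G(e L e)].  Let [X] generate [e L e], let [P] be a partition of [e], and
    let [f1 <= f] be a projection of very small trace [d].  By comparison of projections every [p] in
    [P] is a sum of at most [T(p)/d + 1] pieces [u^* u] with [u u^* <= f1], and [f - f1] is a sum of at
    most [T(f)/d] pieces [w^* w] with [w w^* <= f1].  The elements [u x v^*], for [x] in [X], [u] a piece
    of [p], [v] a piece of [q] and [p x q <> 0], together with the [w], generate [f L f]; with respect
    to the partition of [f] into [f1] and the [w^* w] each of them costs at most [d^2], so that the
    total cost is [sum T(p) T(q) + O(d)], the sum running over the triples with [p x q <> 0].
    Comparison of projections needs maximal partial isometries, obtained from an ordering principle
    driven by the trace, and the existence of a nonzero partial isometry in every nonzero space closed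
    under [(a, b, c) |-> a b^* c], obtained as a strong limit of a Newton-Schulz iteration. *)

From HB Require Import structures.
Require Import Defs.
From mathcomp Require Import all_boot all_order all_algebra finmap.
From mathcomp Require Import complex.
From mathcomp Require Import all_classical all_reals all_analysis.
From mathcomp Require Import ring lra.

Set Implicit Arguments.
Unset Strict Implicit.
Unset Printing Implicit Defensive.

Import Order.TTheory GRing.Theory Num.Theory.

Local Open Scope classical_set_scope.
Local Open Scope ring_scope.
Local Open Scope complex_scope.

(** * Hilbert spaces *)

(** The exponent 2 comes from the two traces in each term of the invariant: a triple of weight
    [T(p) T(q)] is traded for about [T(p) T(q) / d^2] elements of cost at most [d^2], and only the
    rounding is lost. Exchanging [e] and [f] turns the inequality into an equality. One piece [u]
    must have [u * adj u] equal to [f1], not merely below it: through it the compressed generators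
    yield all of [f1 L f1], and from there the [w] reach [f L f]. Since [T(e)] is positive, some [p]
    in [P] is nonzero, and [d] is taken below its trace to secure such a piece. Comparison usually
    rests on polar decomposition and Zorn's lemma. Here the partial isometries come from polynomial
    expressions that never leave the space closed under the ternary product, and maximality only
    uses countable chains, whose bounds are strong limits of sequences. Factoriality enters as
    primeness: [a L b = 0] forces [a = 0] or [b = 0], a property that matrices inherit through their
    entries. *)

Section HilbertBasics.
Variables (R : realType) (H : hilbertSpace R).
Implicit Types (x y z : H) (a : R[i]).

Lemma hdotDl x y z : hdot (x + y) z = hdot x z + hdot y z.
Proof. exact: linearDl. Qed.

Lemma hdotDr x y z : hdot x (y + z) = hdot x y + hdot x z.
Proof. exact: linearDr. Qed.

Lemma hdotNl x y : hdot (- x) y = - hdot x y.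
Proof. exact: linearNl. Qed.

Lemma hdotNr x y : hdot x (- y) = - hdot x y.
Proof. exact: linearNr. Qed.

Lemma hdot0l x : hdot 0 x = 0.
Proof. exact: linear0l. Qed.

Lemma hdot0r x : hdot x 0 = 0.
Proof. exact: linear0r. Qed.

Lemma hdotBl x y z : hdot (x - y) z = hdot x z - hdot y z.
Proof. by rewrite hdotDl hdotNl. Qed.

Lemma hdotBr x y z : hdot x (y - z) = hdot x y - hdot x z.
Proof. by rewrite hdotDr hdotNr. Qed.

Lemma hdotZl a x y : hdot (a *: x) y = a * hdot x y.
Proof. exact: linearZl_LR. Qed.

Lemma hdotZr a x y : hdot x (a *: y) = Num.conj a * hdot x y.
Proof. exact: linearZr_LR. Qed.

Lemma hdotC x y : hdot x y = Num.conj (hdot y x).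
Proof. by rewrite /hdot hermC expr0 mul1r. Qed.

Lemma hdot_ge0 x : 0 <= hdot x x.
Proof. exact: dnorm_ge0. Qed.

Lemma hdot_eq0 x : (hdot x x == 0) = (x == 0).
Proof. exact: dnorm_eq0. Qed.

Lemma hdotE x : hdot x x = (hnorm x ^+ 2)%:C.
Proof.
have x0 := hdot_ge0 x.
have Rx : (complex.Re (hdot x x))%:C = hdot x x by rewrite RRe_real// ger0_real.
by rewrite /hnorm /dot_norm sqr_sqrtr ?Rx// -ler0c Rx.
Qed.

Lemma hnorm_ge0 x : 0 <= hnorm x.
Proof. exact: sqrtr_ge0. Qed.

Lemma hnorm_sqrE x : hnorm x ^+ 2 = complex.Re (hdot x x).
Proof. by rewrite hdotE. Qed.

Lemma hnorm_eq0 x : (hnorm x == 0) = (x == 0).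
Proof.
rewrite -hdot_eq0 hdotE -sqrf_eq0.
by apply/eqP/eqP => [->//|[]].
Qed.

Lemma hnorm0 : hnorm (0 : H) = 0.
Proof. by apply/eqP; rewrite hnorm_eq0. Qed.

Lemma hnormN x : hnorm (- x) = hnorm x.
Proof. by rewrite /hnorm /dot_norm hdotNl hdotNr opprK. Qed.

Lemma hnormB x y : hnorm (x - y) = hnorm (y - x).
Proof. by rewrite -hnormN opprB. Qed.

Lemma cauchy_schwarz x y : `|hdot x y| <= (hnorm x * hnorm y)%:C.
Proof.
have [->|y0] := eqVneq y 0; first by rewrite hdot0r normr0 hnorm0 mulr0.
have yy0 : 0 < hdot y y by rewrite lt_def hdot_eq0 y0 hdot_ge0.
have nK : Num.conj (hdot y y) = hdot y y by rewrite -hdotC.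
have := hdot_ge0 (x - (hdot x y / hdot y y) *: y).
rewrite hdotBl !hdotBr !hdotZl !hdotZr.
rewrite -[hdot y x in X in _ - X]conjCK -(hdotC x y).
have -> : hdot x y / hdot y y * (Num.conj (hdot x y / hdot y y) * hdot y y)
    = hdot x y / hdot y y * Num.conj (hdot x y).
  by rewrite fmorph_div/= nK divfK ?gt_eqF.
rewrite subrr subr0 fmorph_div/= nK subr_ge0 mulrAC ler_pdivrMr// mulrC -normCK.
rewrite !hdotE -rmorphM -exprMn rmorphXn/=.
by rewrite ler_pXn2r// ?nnegrE ?normr_ge0// ler0c mulr_ge0 ?hnorm_ge0.
Qed.

Lemma hnormZ a x : (hnorm (a *: x))%:C = `|a| * (hnorm x)%:C.
Proof.
apply/eqP; rewrite -(@eqrXn2 _ 2)// ?mulr_ge0 ?normr_ge0 ?ler0c ?hnorm_ge0//.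
have sqE (z : H) : (hnorm z)%:C ^+ 2 = hdot z z by rewrite hdotE rmorphXn.
by rewrite exprMn !sqE hdotZl hdotZr mulrA normCK.
Qed.

Lemma hnorm_sqrD x y :
  hnorm (x + y) ^+ 2 = hnorm x ^+ 2 + hnorm y ^+ 2 + 2 * complex.Re (hdot x y).
Proof.
rewrite !hnorm_sqrE hdotDl !hdotDr (hdotC y x) !raddfD/=.
have -> (z : R[i]) : complex.Re (Num.conj z) = complex.Re z by case: z.
by ring.
Qed.

Lemma Re_hdot_le x y : `|complex.Re (hdot x y)| <= hnorm x * hnorm y.
Proof.
rewrite -lecR; apply: le_trans (cauchy_schwarz x y).
case: (hdot x y) => u v /=.
by rewrite normc_def lecR -sqrtr_sqr ler_wsqrtr// lerDl sqr_ge0.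
Qed.

Lemma ler_hnormD x y : hnorm (x + y) <= hnorm x + hnorm y.
Proof.
rewrite -(@ler_pXn2r _ 2)// ?nnegrE ?addr_ge0 ?hnorm_ge0// hnorm_sqrD sqrrD.
have := Re_hdot_le x y; have := ler_norm (complex.Re (hdot x y)).
set r := complex.Re _; set s := `|r|; set u := hnorm x * hnorm y => h1 h2.
rewrite -mulr_natl; lra.
Qed.

Lemma ler_hnormB x y : hnorm (x - y) <= hnorm x + hnorm y.
Proof. by rewrite -(hnormN y) ler_hnormD. Qed.

Lemma ler_hnorm_sum (I : Type) (r : seq I) (F : I -> H) :
  hnorm (\sum_(i <- r) F i) <= \sum_(i <- r) hnorm (F i).
Proof.
elim/big_rec2: _ => [|i u v _ le]; first by rewrite hnorm0.
by apply: le_trans (ler_hnormD _ _) _; rewrite lerD2l.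
Qed.

Lemma hdot_inj x y : (forall z, hdot x z = hdot y z) -> x = y.
Proof.
move=> e; apply/eqP; rewrite -subr_eq0 -hdot_eq0 hdotBl !hdotBr.
by rewrite !e subrr.
Qed.

Definition hcvg (u : nat -> H) (l : H) : Prop :=
  forall e : R, 0 < e -> exists N : nat, forall n : nat, (N <= n)%N -> hnorm (u n - l) < e.

Lemma hcvg_unique u l l' : hcvg u l -> hcvg u l' -> l = l'.
Proof.
move=> ul ul'; apply/eqP; rewrite -subr_eq0 -hnorm_eq0; apply/eqP/le_anti.
rewrite hnorm_ge0 andbT; apply/ler_addgt0Pr => e e0; rewrite add0r.
have e20 : 0 < e / 2 by rewrite divr_gt0.
have [N Nl] := ul _ e20; have [N' Nl'] := ul' _ e20.
have -> : l - l' = (u (maxn N N') - l') - (u (maxn N N') - l) by rewrite opprB [RHS]addrC addrA subrK.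
apply: le_trans (ler_hnormB _ _) _; rewrite [leRHS]splitr ltW// ltrD//.
  by apply: Nl'; rewrite leq_maxr.
by apply: Nl; rewrite leq_maxl.
Qed.

Lemma hcvg_const (u : nat -> H) l N : (forall n, (N <= n)%N -> u n = l) -> hcvg u l.
Proof. by move=> ul e e0; exists N => n /ul ->; rewrite subrr hnorm0. Qed.

Lemma hcvgD u v l l' : hcvg u l -> hcvg v l' -> hcvg (fun n => u n + v n) (l + l').
Proof.
move=> ul vl e e0; have e20 : 0 < e / 2 by rewrite divr_gt0.
have [N Nl] := ul _ e20; have [N' Nl'] := vl _ e20.
exists (maxn N N') => n; rewrite geq_max => /andP[/Nl h /Nl' h'].
have -> : u n + v n - (l + l') = (u n - l) + (v n - l') by rewrite opprD addrACA.
by apply: le_lt_trans (ler_hnormD _ _) _; rewrite [ltRHS]splitr ltrD.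
Qed.

Lemma hcvg_bounded (f : H -> H) (k : R) u l :
  (forall x y, hnorm (f x - f y) <= k * hnorm (x - y)) ->
  hcvg u l -> hcvg (f \o u) (f l).
Proof.
move=> fk ul e e0.
have k1 : 0 < `|k| + 1 by rewrite ltr_wpDl.
have [N Nl] := ul (e / (`|k| + 1)) (divr_gt0 e0 k1).
exists N => n /Nl h; apply: le_lt_trans (fk _ _) _.
apply: (@le_lt_trans _ _ ((`|k| + 1) * hnorm (u n - l))).
  by rewrite ler_wpM2r ?hnorm_ge0// ler_wpDr// ler_norm.
by rewrite mulrC -ltr_pdivlMr.
Qed.

Lemma hcvg_hdot u l y : hcvg u l -> forall e : R, 0 < e ->
  exists N : nat, forall n : nat, (N <= n)%N -> `|hdot (u n) y - hdot l y| < e%:C.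
Proof.
move=> ul e e0; have k1 : 0 < hnorm y + 1 by rewrite ltr_wpDl ?hnorm_ge0.
have [N Nl] := ul (e / (hnorm y + 1)) (divr_gt0 e0 k1).
exists N => n /Nl h; rewrite -hdotBl; apply: le_lt_trans (cauchy_schwarz _ _) _.
rewrite ltcR; apply: (@le_lt_trans _ _ (hnorm (u n - l) * (hnorm y + 1))).
  by rewrite ler_wpM2l ?hnorm_ge0// lerDl.
by rewrite -ltr_pdivlMr.
Qed.

Lemma hcvg_hnorm_le u l (k : R) : hcvg u l -> (forall n, hnorm (u n) <= k) -> hnorm l <= k.
Proof.
move=> ul uk; apply/ler_addgt0Pr => e e0; have [N /(_ N (leqnn _)) h] := ul _ e0.
have -> : l = u N - (u N - l) by rewrite opprB [RHS]addrC subrK.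
by apply: le_trans (ler_hnormB _ _) _; rewrite lerD// ltW.
Qed.

End HilbertBasics.

(** * The *-ring of adjointable operators *)

Section OperatorRing.
Variables (R : realType) (H : hilbertSpace R).

Definition adjointable (f : H -> H) : Prop :=
  bounded_operator f /\ exists2 g, bounded_operator g & is_adjoint f g.

(** Composition of bare functions does not distribute over sums on both sides; bounded operators
    with an adjoint do form a *-ring. The proof field is a boolean, hence irrelevant, so equality of
    operators is equality of functions. *)
Record op := Op { op_fun :> H -> H; op_adjointable : `[< adjointable op_fun >] }.

HB.instance Definition _ := [isSub for op_fun].
HB.instance Definition _ := [Choice of op by <:].

Implicit Types (a b c : op) (x y : H).

Lemma opP a : adjointable a.
Proof. exact/asboolP/op_adjointable. Qed.

Definition mkop f (fP : adjointable f) : op := Op (asboolT fP).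

Lemma op_eq a b : (forall x, a x = b x) -> a = b.
Proof. by move=> ab; apply/val_inj/funext. Qed.

Lemma op_linear a : linear a.
Proof. by have [[]] := opP a. Qed.

HB.instance Definition _ a := GRing.isLinear.Build R[i] H H *:%R a (op_linear a).

Lemma op_bound a : exists2 k : R, 0 <= k & forall x, hnorm (a x) <= k * hnorm x.
Proof.
have [[_ [k ka]] _] := opP a; exists `|k| => [|x]; first exact: normr_ge0.
by apply: le_trans (ka x) _; rewrite ler_wpM2r ?hnorm_ge0 ?ler_norm.
Qed.

Lemma bounded_lin (f g : H -> H) (s : R[i]) :
  bounded_operator f -> bounded_operator g -> bounded_operator (fun x => s *: f x + g x).
Proof.
move=> [lf [k kf]] [lg [l lg']]; split.
  move=> u x y; rewrite lf lg !scalerDr !scalerA !addrA; congr (_ + _).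
  by rewrite mulrC addrAC.
have [r rE] : exists r : R, `|s| = r%:C.
  exists (complex.Re `|s|); apply/esym; rewrite RRe_real ?ger0_real//.
have r0 : 0 <= r by rewrite -ler0c -rE.
exists (r * k + l) => x; apply: le_trans (ler_hnormD _ _) _.
rewrite mulrDl lerD//.
have -> : hnorm (s *: f x) = r * hnorm (f x).
  by apply: complexI; rewrite hnormZ rE -rmorphM.
by rewrite -mulrA ler_wpM2l.
Qed.

Lemma bounded_comp (f g : H -> H) :
  bounded_operator f -> bounded_operator g -> bounded_operator (f \o g).
Proof.
move=> [lf [k kf]] [lg [l lg']]; split=> [u x y /=|]; first by rewrite lg lf.
exists (`|k| * l) => x /=; apply: le_trans (kf _) _.
rewrite -mulrA; apply: le_trans (_ : `|k| * hnorm (g x) <= _).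
  by rewrite ler_wpM2r ?hnorm_ge0 ?ler_norm.
by rewrite ler_wpM2l.
Qed.

Lemma bounded_id : bounded_operator (@idfun H).
Proof. by split=> //; exists 1 => x; rewrite mul1r. Qed.

Lemma bounded_zero : bounded_operator (fun _ : H => 0 : H).
Proof.
split=> [u x y|]; first by rewrite scaler0 addr0.
by exists 0 => x; rewrite mul0r hnorm0.
Qed.

Lemma adjointable_lin (f g : H -> H) (s : R[i]) :
  adjointable f -> adjointable g -> adjointable (fun x => s *: f x + g x).
Proof.
move=> [bf [f' bf' ff']] [bg [g' bg' gg']]; split; first exact: bounded_lin.
exists (fun x => Num.conj s *: f' x + g' x); first exact: bounded_lin.
by move=> x y; rewrite hdotDl hdotDr hdotZl hdotZr ff' gg' conjCK.
Qed.

Lemma adjointable_comp (f g : H -> H) :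
  adjointable f -> adjointable g -> adjointable (f \o g).
Proof.
move=> [bf [f' bf' ff']] [bg [g' bg' gg']]; split; first exact: bounded_comp.
exists (g' \o f'); first exact: bounded_comp.
by move=> x y /=; rewrite ff' gg'.
Qed.

Lemma adjointable_id : adjointable (@idfun H).
Proof. by split; [exact: bounded_id|exists idfun; [exact: bounded_id|]]. Qed.

Lemma adjointable_zero : adjointable (fun _ : H => 0 : H).
Proof.
split; [exact: bounded_zero|exists (fun _ => 0); [exact: bounded_zero|]].
by move=> x y; rewrite hdot0l hdot0r.
Qed.

Definition op0 := mkop adjointable_zero.
Definition op1 := mkop adjointable_id.
(** Sum, opposite and scaling are all instances of this one combination, so that boundedness and
    adjoints are verified once. *)
Definition op_lin (s : R[i]) a b := mkop (adjointable_lin s (opP a) (opP b)).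
Definition op_mul a b := mkop (adjointable_comp (opP a) (opP b)).
Definition op_add a b := op_lin 1 a b.
Definition op_opp a := op_lin (-1) a op0.
Definition op_scale (s : R[i]) a := op_lin s a op0.

Let op_addA : associative op_add.
Proof. by move=> a b c; apply: op_eq => x /=; rewrite !scale1r addrA. Qed.
Let op_addC : commutative op_add.
Proof. by move=> a b; apply: op_eq => x /=; rewrite !scale1r addrC. Qed.
Let op_add0 : left_id op0 op_add.
Proof. by move=> a; apply: op_eq => x /=; rewrite scale1r add0r. Qed.
Let op_addN : left_inverse op0 op_opp op_add.
Proof.
by move=> a; apply: op_eq => x /=; rewrite scale1r addr0 scaleN1r addNr.
Qed.

HB.instance Definition _ := GRing.isZmodule.Build op op_addA op_addC op_add0 op_addN.

Let op_mulA : associative op_mul.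
Proof. by move=> a b c; apply: op_eq. Qed.
Let op_mul1 : left_id op1 op_mul.
Proof. by move=> a; apply: op_eq. Qed.
Let op_mulr1 : right_id op1 op_mul.
Proof. by move=> a; apply: op_eq. Qed.
Let op_mulDl : left_distributive op_mul +%R.
Proof. by move=> a b c; apply: op_eq. Qed.
Let op_mulDr : right_distributive op_mul +%R.
Proof. by move=> a b c; apply: op_eq => x /=; rewrite !scale1r linearD. Qed.

HB.instance Definition _ :=
  GRing.Zmodule_isPzRing.Build op op_mulA op_mul1 op_mulr1 op_mulDl op_mulDr.

Let op_scaleA s s' a : op_scale s (op_scale s' a) = op_scale (s * s') a.
Proof. by apply: op_eq => x /=; rewrite !addr0 scalerA. Qed.
Let op_scale1 : left_id 1 op_scale.
Proof. by move=> a; apply: op_eq => x /=; rewrite addr0 scale1r. Qed.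
Let op_scaleDr : right_distributive op_scale +%R.
Proof.
by move=> s a b; apply: op_eq => x /=; rewrite !addr0 !scale1r scalerDr.
Qed.
Let op_scaleDl a : {morph op_scale^~ a : s s' / s + s'}.
Proof.
by move=> s s'; apply: op_eq => x /=; rewrite !addr0 !scale1r scalerDl.
Qed.

HB.instance Definition _ :=
  GRing.Zmodule_isLmodule.Build R[i] op op_scaleA op_scale1 op_scaleDr op_scaleDl.

Lemma op0E x : (0 : op) x = 0. Proof. by []. Qed.
Lemma op1E x : (1 : op) x = x. Proof. by []. Qed.
Lemma opDE a b x : (a + b) x = a x + b x.
Proof. by rewrite /= scale1r. Qed.
Lemma opNE a x : (- a) x = - a x.
Proof. by rewrite /= addr0 scaleN1r. Qed.
Lemma opBE a b x : (a - b) x = a x - b x.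
Proof. by rewrite opDE opNE. Qed.
Lemma opME a b x : (a * b) x = a (b x).
Proof. by []. Qed.
Lemma opZE (s : R[i]) a x : (s *: a) x = s *: a x.
Proof. by rewrite /= addr0. Qed.
Definition opE := (op0E, op1E, opDE, opNE, opME, opZE).

Lemma op_scalerAl (s : R[i]) a b : s *: (a * b) = (s *: a) * b.
Proof. by apply: op_eq => x; rewrite !opE. Qed.
Lemma op_scalerAr (s : R[i]) a b : s *: (a * b) = a * (s *: b).
Proof. by apply: op_eq => x; rewrite !opE linearZ. Qed.

Lemma adj_ex a : exists b, forall x y, hdot (a x) y = hdot x (b y).
Proof.
have [af [g gb ag]] := opP a.
have gP : adjointable g.
  split=> //; exists a; first by case: (opP a).
  by move=> x y; rewrite hdotC -ag -hdotC.
by exists (mkop gP).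
Qed.

Definition adj a : op := sval (cid (adj_ex a)).

Lemma adjP a x y : hdot (a x) y = hdot x (adj a y).
Proof. by rewrite /adj; case: cid. Qed.

Lemma adjP' a x y : hdot (adj a x) y = hdot x (a y).
Proof. by rewrite hdotC -adjP -hdotC. Qed.

Lemma adj_unique a (g : H -> H) : is_adjoint a g -> g =1 adj a.
Proof.
by move=> ag y; apply: hdot_inj => z; rewrite hdotC -ag -hdotC adjP'.
Qed.

Lemma adj_eq a b : (forall x y, hdot (a x) y = hdot x (b y)) -> adj a = b.
Proof. by move=> ab; apply: op_eq => x; rewrite -(adj_unique ab). Qed.

Lemma adjK : involutive adj.
Proof. by move=> a; apply: adj_eq => x y; rewrite adjP'. Qed.
Lemma adj1 : adj 1 = 1.
Proof. exact: adj_eq. Qed.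
Lemma adjD : {morph adj : a b / a + b}.
Proof. by move=> a b; apply: adj_eq => x y; rewrite !opE hdotDl hdotDr !adjP. Qed.
Lemma adjZ (s : R[i]) a : adj (s *: a) = Num.conj s *: adj a.
Proof. by apply: adj_eq => x y; rewrite !opE hdotZl hdotZr !adjP conjCK. Qed.
Lemma adjM a b : adj (a * b) = adj b * adj a.
Proof. by apply: adj_eq => x y; rewrite !opE !adjP. Qed.
Lemma adj0 : adj 0 = 0.
Proof. by rewrite -[X in adj X](scale0r (0 : op)) adjZ conjC0 scale0r. Qed.
Lemma adjN : {morph adj : a / - a}.
Proof. by move=> a; rewrite -scaleN1r adjZ rmorphN1 scaleN1r. Qed.
Lemma adjB : {morph adj : a b / a - b}.
Proof. by move=> a b; rewrite adjD adjN. Qed.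

Definition opos a : Prop := positive_operator a.

Lemma oposD a b : opos a -> opos b -> opos (a + b).
Proof. by move=> ha hb x; rewrite opE hdotDl addr_ge0. Qed.

Lemma oposZ (s : R[i]) a : 0 <= s -> opos a -> opos (s *: a).
Proof. by move=> s0 ha x; rewrite opE hdotZl mulr_ge0. Qed.

Lemma opos_conj a b : opos a -> opos (adj b * a * b).
Proof. by move=> ha x; rewrite !opE adjP'. Qed.

Lemma opos_sqr a : opos (adj a * a).
Proof. by move=> x; rewrite !opE adjP' hdot_ge0. Qed.

Lemma adj_mul_hnorm a x : hdot ((adj a * a) x) x = (hnorm (a x) ^+ 2)%:C.
Proof. by rewrite opE adjP' hdotE. Qed.

Lemma adj_mul_eq0 a : adj a * a = 0 -> a = 0.
Proof.
move=> aa; apply: op_eq => x; apply/eqP; rewrite -hnorm_eq0 -sqrf_eq0.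
by have := adj_mul_hnorm a x; rewrite aa opE hdot0l => -[<-].
Qed.

Lemma op_hcvg a (u : nat -> H) l : hcvg u l -> hcvg (a \o u) (a l).
Proof.
have [k k0 ka] := op_bound a.
by apply: (@hcvg_bounded _ _ a k) => x y; rewrite -raddfB; exact: ka.
Qed.

Lemma hcvgZ (s : R[i]) (u : nat -> H) l : hcvg u l -> hcvg (fun n => s *: u n) (s *: l).
Proof.
move=> /(op_hcvg (s *: (1 : op) : op)); rewrite opZE.
by congr hcvg; apply/funext => n; rewrite /comp opZE.
Qed.

End OperatorRing.

(** * Partial isometries in von Neumann algebras *)

Section VonNeumann.
Variables (R : realType) (H : hilbertSpace R) (A : set (H -> H)).
Hypothesis vnA : von_neumann_algebra A.
Implicit Types (a b c : op H) (x y : H).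

Lemma vna_adjointable f : A f -> adjointable f.
Proof.
move=> Af; split; first exact: (vna_bounded vnA).
by have [g Ag fg] := vna_adjoint vnA Af; exists g => //; exact: (vna_bounded vnA).
Qed.

Lemma vna_op f : A f -> exists a, op_fun a = f.
Proof. by move=> Af; exists (mkop (vna_adjointable Af)). Qed.

Lemma vna0 : A (0 : op H).
Proof. exact: (vna_zero vnA). Qed.

Lemma vnaD a b : A a -> A b -> A (a + b).
Proof. exact: (vna_linear vnA 1). Qed.

Lemma vnaZ (s : R[i]) a : A a -> A (s *: a).
Proof. by move=> Aa; exact: (vna_linear vnA s Aa (vna_zero vnA)). Qed.

Lemma vnaN a : A a -> A (- a).
Proof. by move=> Aa; rewrite -scaleN1r; exact: vnaZ. Qed.

Lemma vnaB a b : A a -> A b -> A (a - b).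
Proof. by move=> Aa Ab; apply: vnaD => //; exact: vnaN. Qed.

Lemma vnaM a b : A a -> A b -> A (a * b).
Proof. exact: (vna_mul vnA). Qed.

Lemma vna_adj a : A a -> A (adj a).
Proof.
by move=> /(vna_adjoint vnA)[g Ag /adj_unique/funext ag]; rewrite -ag.
Qed.

Lemma vna_sum (I : Type) (r : seq I) (P : pred I) (F : I -> op H) :
  (forall i, A (F i)) -> A (\sum_(i <- r | P i) F i).
Proof.
by move=> AF; elim/big_ind: _ => [|a b|]//; [exact: vna0|exact: vnaD].
Qed.

(** A basic weak neighbourhood tests only finitely many pairs of vectors, so one index of a strongly
    convergent sequence serves them all. *)
Lemma vna_pointwise_closed (u : nat -> op H) (l : H -> H) :
  bounded_operator l -> (forall k, A (u k)) ->
  (forall x, hcvg (fun n => u n x) (l x)) -> A l.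
Proof.
move=> bl Au ul; apply: (vna_closed vnA); split=> // s e e0.
have [N NP] : exists N, forall n, (N <= n)%N -> forall x y, (x, y) \in s ->
    `|hdot (u n x) y - hdot (l x) y| < e%:C.
  elim: s => [|[x y] s [N NP]]; first by exists 0%N => n _ x y; rewrite in_nil.
  have [N' NP'] := hcvg_hdot y (ul x) e0.
  exists (maxn N N') => n; rewrite geq_max => /andP[/NP h /NP' h'] x' y'.
  by rewrite in_cons => /orP[/eqP[-> ->]//|/h].
exists (u N) => // x y /(NP _ (leqnn _)).
by rewrite distrC -hdotBl.
Qed.

Lemma bounded_limit (u : nat -> op H) (l : H -> H) :
  (forall k x, hnorm (u k x) <= hnorm x) ->
  (forall x, hcvg (fun n => u n x) (l x)) -> bounded_operator l.
Proof.
move=> u1 ul; split=> [s x y|]; last first.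
  by exists 1 => x; rewrite mul1r; exact: (hcvg_hnorm_le (ul x)).
apply: (hcvg_unique (ul _)).
under eq_fun do rewrite linearP.
by apply: hcvgD; [exact/hcvgZ/ul|exact: ul].
Qed.

(** The increments are dominated by those of the bounded nondecreasing real sequence
    [hnorm (u k x) ^+ 2], so each orbit is Cauchy. Stated through norms, it applies both to the
    Newton-Schulz iterates and to chains of partial isometries. *)
Lemma monotone_strong_limit (u : nat -> op H) :
  (forall k, A (u k)) -> (forall k x, hnorm (u k x) <= hnorm x) ->
  (forall k l x, (k <= l)%N ->
    hnorm (u l x - u k x) ^+ 2 <= hnorm (u l x) ^+ 2 - hnorm (u k x) ^+ 2) ->
  exists2 a : op H, A a & forall x, hcvg (fun n => u n x) (a x).
Proof.
move=> Au u1 umono.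
have cvg_u x : exists l, hcvg (fun n => u n x) l.
  apply: (hilbert_complete (u := fun n => u n x)) => e e0.
  pose E := [set hnorm (u k x) ^+ 2 | k in setT].
  have supE : has_sup E.
    split; first by exists (hnorm (u 0%N x) ^+ 2); exists 0%N.
    by exists (hnorm x ^+ 2) => _ [k _ <-]; rewrite lerXn2r ?nnegrE ?hnorm_ge0.
  have [_ [N _ <-] ltN] := sup_adherent (exprn_gt0 2 e0) supE.
  have le_sup k : hnorm (u k x) ^+ 2 <= sup E.
    by apply: ub_le_sup; [case: supE|exists k].
  have incr k l : (k <= l)%N -> hnorm (u k x) ^+ 2 <= hnorm (u l x) ^+ 2.
    by move=> /umono h; rewrite -subr_ge0; apply: le_trans (h x); rewrite sqr_ge0.
  have main k l : (N <= k)%N -> (k <= l)%N -> hnorm (u l x - u k x) < e.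
    move=> Nk kl; rewrite -(@ltr_pXn2r _ 2)// ?nnegrE ?hnorm_ge0 ?(ltW e0)//.
    apply: le_lt_trans (umono _ _ _ kl) _.
    by have := le_sup l; have := incr _ _ Nk; lra.
  exists N => m n Nm Nn; have [mn|/ltnW nm] := leqP m n; last exact: main.
  by have := main _ _ Nm mn; rewrite hnormB.
have [l ul] := choice cvg_u.
have bl := bounded_limit u1 ul.
have [a al] := vna_op (vna_pointwise_closed bl Au ul).
by exists a; rewrite al//; exact: vna_pointwise_closed ul.
Qed.

(* Closure under the ternary product covers corners [f A r] and one-sided ideals at once. *)
Record ternary (T : set (op H)) : Prop := {
  ternaryD : forall a b, T a -> T b -> T (a + b);
  ternaryZ : forall (s : R[i]) a, T a -> T (s *: a);
  ternaryM : forall a b c, T a -> T b -> T c -> T (a * adj b * c);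
  ternary_closed : forall (u : nat -> op H) a, (forall k, T (u k)) ->
    (forall x, hcvg (fun n => u n x) (a x)) -> T a
}.

Definition partial_isometry a := a * adj a * a = a.

(** * Positivity of polynomials in an operator between 0 and 1 *)

Section Positivity.
Variable c : op H.
Hypotheses (cadj : adj c = c) (c0 : opos c) (c1 : opos (1 - c)).

(** These are the polynomials in [c] with nonnegative coefficients, given by closure rules so that
    commutation, self-adjointness and positivity follow by induction. An inequality [0 <= s] in
    [R[i]] forces [s] to be real. *)
Inductive nonneg_poly : op H -> Prop :=
| nonneg_poly1 : nonneg_poly 1
| nonneg_polyX a : nonneg_poly a -> nonneg_poly (a * c)
| nonneg_polyD a b : nonneg_poly a -> nonneg_poly b -> nonneg_poly (a + b)
| nonneg_polyZ (s : R[i]) a : 0 <= s -> nonneg_poly a -> nonneg_poly (s *: a).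

Lemma nonneg_polyM a b : nonneg_poly a -> nonneg_poly b -> nonneg_poly (a * b).
Proof.
move=> pa; elim=> [|b' _ pb|b1 b2 _ p1 _ p2|s b' s0 _ pb].
- by rewrite mulr1.
- by rewrite mulrA; exact: nonneg_polyX.
- by rewrite mulrDr; exact: nonneg_polyD.
- by rewrite -op_scalerAr; exact: nonneg_polyZ.
Qed.

Lemma comm_scale (s : R[i]) a b : GRing.comm a b -> GRing.comm a (s *: b).
Proof. by rewrite /GRing.comm -op_scalerAr -op_scalerAl => ->. Qed.

Lemma nonneg_poly_comm a b : GRing.comm b c -> nonneg_poly a -> GRing.comm b a.
Proof.
move=> bc; elim=> [|a' _ p|a1 a2 _ p1 _ p2|s a' s0 _ p].
- exact: commr1.
- exact: commrM.
- exact: commrD.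
- exact: comm_scale.
Qed.

Lemma nonneg_poly_comm2 a b : nonneg_poly a -> nonneg_poly b -> GRing.comm a b.
Proof.
by move=> pa pb; apply: nonneg_poly_comm => //; apply/commr_sym/nonneg_poly_comm.
Qed.

Lemma nonneg_poly_adj a : nonneg_poly a -> adj a = a.
Proof.
elim=> [|a' pa p|a1 a2 _ p1 _ p2|s a' s0 _ p].
- exact: adj1.
- by rewrite adjM p cadj; exact: nonneg_poly_comm.
- by rewrite adjD p1 p2.
- by rewrite adjZ p geC0_conj.
Qed.

(* [(1 - c) c = c (1 - c) c + (1 - c) c (1 - c)] *)
Lemma opos_1Bc_c : opos ((1 - c) * c).
Proof.
have [cc badj] : GRing.comm (1 - c) c /\ adj (1 - c) = 1 - c.
  by split; [apply/commr_sym/commrB => //; exact: commr1|rewrite adjB adj1 cadj].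
move: cc badj c1; set b := 1 - c => cc badj b0.
have -> : b * c = adj c * b * c + adj b * c * b.
  by rewrite cadj badj -cc -mulrDr addrC subrK mulr1.
by apply: oposD; exact: opos_conj.
Qed.

(** This is [c^2 <= c], read off [opos_1Bc_c]. It bounds the norm of [c x] by the quadratic form,
    and so turns convergence of quadratic forms into strong convergence. *)
Lemma hnorm_sqr_le_opos x : hnorm (c x) ^+ 2 <= complex.Re (hdot (c x) x).
Proof.
have := opos_1Bc_c x; rewrite mulrBl mul1r opBE hdotBl opME (adjP c (c x)) cadj (hdotE (c x)).
by rewrite subr_ge0 lecE => /andP[_].
Qed.

(** Conjugation by [c] raises the exponent by two, so both claims reduce to the exponents 0 and 1,
    and no square root of [c] is called for. *)
Lemma opos_cX n : opos (c ^+ n) /\ opos ((1 - c) * c ^+ n).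
Proof.
have cc : GRing.comm (1 - c) c by apply/commr_sym/commrB => //; exact: commr1.
have [m] := ubnP n; elim: m n => // m IH [|[|n]] nm.
- by rewrite expr0 mulr1; split=> // x; rewrite opE hdot_ge0.
- by rewrite expr1; split=> //; exact: opos_1Bc_c.
have [h1 h2] := IH n (ltnW nm).
have -> : c ^+ n.+2 = adj c * c ^+ n * c by rewrite cadj exprS exprSr mulrA.
split; first exact: opos_conj.
have -> : (1 - c) * (adj c * c ^+ n * c) = adj c * ((1 - c) * c ^+ n) * c.
  by rewrite cadj !mulrA cc.
exact: opos_conj.
Qed.

Lemma opos_nonneg_poly a : nonneg_poly a -> opos a /\ opos ((1 - c) * a).
Proof.
move=> pa.
(* Carrying the power [c ^+ n] along makes the case [a * c] a mere shift of [n]. *)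
suff: forall n, opos (a * c ^+ n) /\ opos ((1 - c) * (a * c ^+ n)).
  by move=> /(_ 0%N); rewrite expr0 mulr1.
elim: pa => [n|{}a _ IH n|{}a a' _ IH _ IH' n|s {}a s0 _ IH n].
- by rewrite mul1r; exact: opos_cX.
- by rewrite -mulrA -exprS; exact: IH.
- have [[h1 h2] [h3 h4]] := (IH n, IH' n).
  by rewrite mulrDl mulrDr; split; exact: oposD.
- have [h1 h2] := IH n.
  by rewrite -op_scalerAl -op_scalerAr; split; exact: oposZ.
Qed.

End Positivity.

(* The Newton-Schulz iteration [u' = u (3 - u^* u) / 2] started at a contraction [a]: with
   [c = 1 - a^* a], the iterates are [u = a g] and [1 - u^* u = d], where [g] and [d] are polynomials in
   [c] with nonnegative coefficients. *)
Fixpoint newton_schulz c (n : nat) : op H * op H :=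
  if n is n'.+1 then
    let: (g, d) := newton_schulz c n' in
    (g + (2^-1 : R[i]) *: (g * d),
     (3 / 4 : R[i]) *: (d * d) + (4^-1 : R[i]) *: (d * d * d))
  else (1, c).


(** * The Newton-Schulz iteration and its strong limit *)

Section NewtonSchulz.
Variable a : op H.
Hypothesis a1 : forall x, hnorm (a x) <= hnorm x.

Let b := adj a * a.
Let c := 1 - b.
Let g n := (newton_schulz c n).1.
Let d n := (newton_schulz c n).2.
Let u n := a * g n.

Let badj : adj b = b. Proof. by rewrite adjM adjK. Qed.
Let cadj : adj c = c. Proof. by rewrite adjB adj1 badj. Qed.
Let bc : 1 - c = b. Proof. by rewrite opprB addrC subrK. Qed.
Let b0 : opos (1 - c). Proof. by rewrite bc; exact: opos_sqr. Qed.

Let c0 : opos c.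
Proof.
move=> x; rewrite opBE op1E hdotBl adj_mul_hnorm hdotE subr_ge0 lecR.
by rewrite lerXn2r ?nnegrE ?hnorm_ge0.
Qed.

Let gS n : g n.+1 = g n + (2^-1 : R[i]) *: (g n * d n).
Proof. by rewrite /g /d /=; case: newton_schulz. Qed.

Let dS n : d n.+1 = (3 / 4 : R[i]) *: (d n * d n) + (4^-1 : R[i]) *: (d n * d n * d n).
Proof. by rewrite /g /d /=; case: newton_schulz. Qed.

Let gd_poly n : nonneg_poly c (g n) /\ nonneg_poly c (d n).
Proof.
elim: n => [|n [gP dP]].
  by split; [exact: nonneg_poly1|rewrite -[d 0](mul1r c); exact/nonneg_polyX/nonneg_poly1].
rewrite gS dS; split; apply: nonneg_polyD => //; apply: nonneg_polyZ => //;
  by repeat apply: nonneg_polyM.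
Qed.

Let gP n := (gd_poly n).1.
Let dP n := (gd_poly n).2.

Let bcomm (y : op H) : nonneg_poly c y -> GRing.comm b y.
Proof.
apply: nonneg_poly_comm; apply/commrB; first exact: commr1.
by [].
Qed.

(** Since [g] is multiplied by [1 + d/2], the new defect is [1 - (1 - d) (1 + d/2)^2 = 3/4 d^2 + 1/4
    d^3]: the linear terms cancel and the coefficients stay nonnegative. *)
Let bgg n : b * (g n * g n) = 1 - d n.
Proof.
elim: n => [|n IH]; first by rewrite /g /d /= !mulr1 -bc.
have gd : GRing.comm (g n) (d n) by exact: (nonneg_poly_comm2 (gP n) (dP n)).
have e : g n.+1 = g n * (1 + (2^-1 : R[i]) *: d n).
  by rewrite gS mulrDr mulr1 op_scalerAr.
have ge : GRing.comm (g n) (1 + (2^-1 : R[i]) *: d n).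
  by apply: commrD; [exact: commr1|exact: comm_scale].
have ee : (1 + (2^-1 : R[i]) *: d n) * (1 + (2^-1 : R[i]) *: d n) =
    1 + d n + (4^-1 : R[i]) *: (d n * d n).
  rewrite mulrDl mul1r mulrDr mulr1 -op_scalerAl -op_scalerAr scalerA.
  have -> : (2^-1 * 2^-1 : R[i]) = 4^-1 by rewrite -invfM -natrM.
  rewrite !addrA; congr (_ + _); rewrite -!addrA; congr (_ + _).
  rewrite -scalerDl; have -> : (2^-1 + 2^-1 : R[i]) = 1 by field.
  by rewrite scale1r.
have -> : b * (g n.+1 * g n.+1) = (1 - d n) *
    ((1 + (2^-1 : R[i]) *: d n) * (1 + (2^-1 : R[i]) *: d n)).
  by rewrite e -[X in _ * X]mulrA [X in _ * (_ * X)]mulrA -ge -!mulrA [RHS]mulrA -IH -!mulrA.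
rewrite ee dS mulrBl mul1r !mulrDr mulr1 -op_scalerAr opprD mulrA.
set p := d n * d n; set q := p * d n.
have -> : (3 / 4 : R[i]) *: p = p - (4^-1 : R[i]) *: p.
  by rewrite -[X in X - _]scale1r -scalerBl; congr (_ *: _); field.
move: (4^-1 *: p) (4^-1 *: q) => z w.
by rewrite !opprD opprK !addrA (addrAC _ z) addrK (addrAC _ z).
Qed.

Let nonneg_poly_incr k l : (k <= l)%N -> exists2 s, g l = g k + s & s = 0 \/ nonneg_poly c s.
Proof.
elim: l => [|l IH]; first by rewrite leqn0 => /eqP->; exists 0; [rewrite addr0|left].
rewrite leq_eqVlt => /orP[/eqP->|]; first by exists 0; [rewrite addr0|left].
move=> /IH[s gl sP].
have stepP : nonneg_poly c ((2^-1 : R[i]) *: (g l * d l)).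
  by apply: nonneg_polyZ => //; exact: nonneg_polyM.
exists (s + (2^-1 : R[i]) *: (g l * d l)); first by rewrite gS {1}gl addrA.
by right; case: sP => [->|sP]; [rewrite add0r|exact: nonneg_polyD].
Qed.

Let uu n : adj (u n) * u n = 1 - d n.
Proof.
rewrite /u adjM (nonneg_poly_adj cadj (gP n)) -bgg -(mulrA (g n)) (mulrA (adj a)) -/b.
by rewrite mulrA -(bcomm (gP n)) -mulrA.
Qed.

(** In this form, free of [g] and [d], the iterates are seen to stay in any ternary space that
    contains [a]. *)
Let uS n : u n.+1 = (3 / 2 : R[i]) *: u n - (2^-1 : R[i]) *: (u n * adj (u n) * u n).
Proof.
rewrite -(mulrA (u n)) uu mulrBr mulr1 scalerBr opprB addrCA -scalerBl.
have -> : (3 / 2 - 2^-1 : R[i]) = 1 by field.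
by rewrite scale1r addrC /u gS mulrDr -op_scalerAr mulrA.
Qed.

Let u_sqr n x : hnorm (u n x) ^+ 2 = hnorm x ^+ 2 - complex.Re (hdot (d n x) x).
Proof.
by rewrite !hnorm_sqrE -adjP' -opME uu opBE op1E hdotBl raddfB.
Qed.

Let d_ge0 n x : 0 <= complex.Re (hdot (d n x) x).
Proof.
have [/(_ x) + _] := opos_nonneg_poly cadj c0 b0 (dP n).
by rewrite lecE => /andP[].
Qed.

Let u_contraction n x : hnorm (u n x) <= hnorm x.
Proof.
rewrite -(@ler_pXn2r _ 2)// ?nnegrE ?hnorm_ge0//.
by rewrite u_sqr gerBl d_ge0.
Qed.

(** With [u l = u k + a * s], the claim is that the cross term is nonnegative. It is the quadratic
    form of [(1 - c) * (s * g k)], which is the purpose of the second conclusion of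
    [opos_nonneg_poly]. *)
Let u_mono k l x : (k <= l)%N ->
  hnorm (u l x - u k x) ^+ 2 <= hnorm (u l x) ^+ 2 - hnorm (u k x) ^+ 2.
Proof.
move=> /nonneg_poly_incr[s gl sP].
have ul : u l = u k + a * s by rewrite /u gl mulrDr.
rewrite ul opDE (addrAC (u k x)) subrr add0r hnorm_sqrD.
suff : 0 <= complex.Re (hdot (u k x) ((a * s) x)) by lra.
rewrite -adjP' -opME; case: sP => [->|sP].
  by rewrite mulr0 adj0 mul0r op0E hdot0l.
have -> : adj (a * s) * u k = (1 - c) * (s * g k).
  rewrite adjM (nonneg_poly_adj cadj sP) -(mulrA s) (mulrA (adj a)) -/b bc.
  by rewrite mulrA -(bcomm sP) -mulrA.
have [_ /(_ x)] := opos_nonneg_poly cadj c0 b0 (nonneg_polyM sP (gP k)).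
by rewrite lecE => /andP[].
Qed.

(** The limit [v] satisfies [v * (1 - adj v * v) = 0], because [u n * d n] converges strongly to the
    left-hand side and equals [2 (u n.+1 - u n)], which tends to 0. The comparison of norms keeps
    [v] from vanishing when [a] does not. *)
Lemma newton_schulz_partial_isometry (T : set (op H)) :
  T `<=` [set y | A y] -> ternary T -> T a ->
  exists2 v, T v /\ partial_isometry v & forall x, hnorm (a x) <= hnorm (v x).
Proof.
move=> TA tT Ta.
have Tu n : T (u n).
  elim: n => [|n IH]; first by rewrite /u mulr1.
  rewrite uS -scaleNr; apply: (ternaryD tT); first exact: ternaryZ.
  by apply: (ternaryZ tT); exact: ternaryM.
have [v Av uv] := monotone_strong_limit (fun n => TA _ (Tu n)) u_contraction u_mono.
have v1 x : hnorm (v x) <= hnorm x.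
  by apply: (hcvg_hnorm_le (uv x)) => n; exact: u_contraction.
have uv_le n x : hnorm (u n x) <= hnorm (v x).
  apply/ler_addgt0Pr => e e0.
  have [N /(_ (maxn N n) (leq_maxl _ _)) h] := uv x e e0.
  have le1 : hnorm (u n x) <= hnorm (u (maxn N n) x).
    rewrite -(@ler_pXn2r _ 2)// ?nnegrE ?hnorm_ge0// -subr_ge0.
    by apply: le_trans (u_mono x (leq_maxr N n)); exact: sqr_ge0.
  apply: (le_trans le1); rewrite -[u (maxn N n) x](subrK (v x)) addrC.
  by apply: le_trans (ler_hnormD _ _) _; rewrite lerD2l ltW.
exists v; last by move=> x; have := uv_le 0%N x; rewrite /u mulr1.
split; first exact: (ternary_closed tT Tu).
have sqr_cvg x e : 0 < e -> exists N, forall n, (N <= n)%N ->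
    hnorm (v x) ^+ 2 - hnorm (u n x) ^+ 2 < e.
  move=> e0; have k0 : 0 < 2 * hnorm x + 1 by rewrite ltr_wpDl ?mulr_ge0 ?hnorm_ge0.
  have [N NP] := uv x _ (divr_gt0 e0 k0); exists N => n /NP h.
  have h' : hnorm (v x) - hnorm (u n x) <= hnorm (u n x - v x).
    by rewrite lerBlDl hnormB -{1}[v x](subrK (u n x)) addrC ler_hnormD.
  have h2 : (hnorm (v x) - hnorm (u n x)) * (2 * hnorm x + 1) < e.
    by rewrite -ltr_pdivlMr//; exact: le_lt_trans h' h.
  apply: le_lt_trans h2; rewrite subr_sqr ler_wpM2l ?subr_ge0//.
  by have := v1 x; have := u_contraction n x; lra.
(* Taking adjoints is not strongly continuous, so this needs an argument: the difference [y] of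
   [adj v * v] and [adj (u n) * u n] lies between 0 and 1, hence [hnorm (y x) ^+ 2] is at most the
   quadratic form of [y] at [x], which tends to 0. *)
have d_cvg x : hcvg (fun n => d n x) ((1 - adj v * v) x).
  have dE n : d n - (1 - adj v * v) = adj v * v - adj (u n) * u n.
    by rewrite uu !opprB addrCA.
  have yle n : hnorm (d n x - (1 - adj v * v) x) ^+ 2 <= hnorm (v x) ^+ 2 - hnorm (u n x) ^+ 2.
    rewrite -opBE dE; set y := adj v * v - _.
    have yE z : hdot (y z) z = (hnorm (v z) ^+ 2 - hnorm (u n z) ^+ 2)%:C.
      by rewrite opBE hdotBl !adj_mul_hnorm -rmorphB.
    have -> : hnorm (v x) ^+ 2 - hnorm (u n x) ^+ 2 = complex.Re (hdot (y x) x) by rewrite yE.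
    apply: hnorm_sqr_le_opos => [|z|z].
    - by rewrite /y adjB !adjM !adjK.
    - by rewrite yE ler0c subr_ge0 lerXn2r ?nnegrE ?hnorm_ge0.
    - rewrite opBE op1E hdotBl yE hdotE -rmorphB ler0c opprB addrA subr_ge0.
      by rewrite ler_wpDr ?sqr_ge0// lerXn2r ?nnegrE ?hnorm_ge0.
  move=> e e0; have [N NP] := sqr_cvg x _ (exprn_gt0 2 e0).
  exists N => n /NP h; rewrite -(@ltr_pXn2r _ 2)// ?nnegrE ?hnorm_ge0 ?(ltW e0)//.
  exact: le_lt_trans (yle n) h.
have ud_cvg x : hcvg (fun n => u n (d n x)) (v ((1 - adj v * v) x)).
  set z := (1 - adj v * v) x.
  have -> : (fun n => u n (d n x)) = (fun n => u n (d n x - z) + u n z).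
    by apply/funext => n; rewrite raddfB subrK.
  rewrite -[v z]add0r; apply: hcvgD => // e e0.
  have [N NP] := d_cvg x _ e0; exists N => n /NP; rewrite subr0.
  exact: le_lt_trans (u_contraction _ _).
have ud_cvg0 x : hcvg (fun n => u n (d n x)) 0.
  have -> : (fun n => u n (d n x)) = (fun n => (2 : R[i]) *: (u n.+1 x + (-1) *: u n x)).
    have uB n : u n.+1 - u n = (2^-1 : R[i]) *: (u n * d n).
      by rewrite /u gS mulrDr addrAC subrr add0r -op_scalerAr mulrA.
    apply/funext => n; rewrite scaleN1r -opBE uB opZE scalerA divff ?pnatr_eq0//.
    by rewrite scale1r.
  rewrite -(scaler0 _ (2 : R[i])) -(subrr (v x)) -(scaleN1r (v x)).
  apply/hcvgZ/hcvgD; last exact/hcvgZ/uv.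
  by move=> e e0; have [N NP] := uv x _ e0; exists N => n Nn; exact/NP/leqW.
apply/eqP; rewrite eq_sym -subr_eq0 -mulrA -[X in X - _]mulr1 -mulrBr; apply/eqP/op_eq => x.
exact: hcvg_unique (ud_cvg x) (ud_cvg0 x).
Qed.

End NewtonSchulz.
End VonNeumann.

(** * Comparison of projections *)

(** The Brezis-Browder ordering principle. The step numbered [n] comes within [1/(n+1)] of the
    supremum of [phi] above the previous element, so an upper bound of this single countable chain
    leaves [phi] no room to grow. *)
Lemma brezis_browder (R : realType) (X : Type) (P : X -> Prop) (le : X -> X -> Prop)
    (phi : X -> R) (B : R) (x0 : X) :
  P x0 -> (forall x, P x -> le x x) ->
  (forall x y z, P x -> P y -> P z -> le x y -> le y z -> le x z) ->
  (forall x y, P x -> P y -> le x y -> phi x <= phi y) ->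
  (forall x, P x -> phi x <= B) ->
  (forall u : nat -> X, (forall n, P (u n)) -> (forall n, le (u n) (u n.+1)) ->
    exists2 v, P v & forall n, le (u n) v) ->
  exists2 x, P x & forall y, P y -> le x y -> phi y <= phi x.
Proof.
move=> P0 refl trans mono bnd chain.
have /choice[step stepP] : forall xn : X * nat, exists y, P xn.1 ->
    [/\ P y, le xn.1 y & forall z, P z -> le xn.1 z -> phi z < phi y + (xn.2.+1%:R)^-1].
  move=> [x n] /=; have [Px|] := pselect (P x); last by exists x.
  pose E := [set phi z | z in [set z | P z /\ le x z]].
  have supE : has_sup E.
    split; first by exists (phi x); exists x => //; split=> //; exact: refl.
    by exists B => _ [z [Pz _] <-]; exact: bnd.
  have n0 : 0 < (n.+1%:R : R)^-1 by rewrite invr_gt0.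
  have [_ [y [Py xy] <-] ly] := sup_adherent n0 supE.
  exists y => _; split=> // z Pz xz; rewrite -ltrBlDr; apply: le_lt_trans ly.
  by rewrite lerD2r; apply: ub_le_sup; [case: supE|exists z].
pose u := fix u n := if n is n'.+1 then step (u n', n') else x0.
have Pu n : P (u n) by elim: n => //= n /(stepP (u n, n))[].
have le_u n : le (u n) (u n.+1) by have [] := stepP (u n, n) (Pu n).
have [v Pv uv] := chain u Pu le_u.
exists v => // y Py vy; apply/ler_addgt0Pr => e e0.
have [n ne] : exists n, (n.+1%:R)^-1 < e.
  exists (Num.truncn e^-1); rewrite invf_plt ?posrE ?ltr0n//.
  exact: truncnS_gt.
have [_ _ /(_ y Py)] := stepP (u n, n) (Pu n) => h.
apply/ltW/(lt_trans (h _)) => /=; first exact: (trans _ v).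
by apply: ler_ltD ne; exact: mono (uv n.+1).
Qed.

(** * Projections and the extension order on partial isometries *)

Section Projections.
Variables (R : realType) (H : hilbertSpace R).
Implicit Types (a p q v w : op H).

Definition projection q := q * q = q /\ adj q = q.

Lemma projectionP q : projection q <-> is_projection q.
Proof.
split=> -[qq qa]; split.
- by have := congr1 (@op_fun R H) qq.
- by move=> x y; rewrite adjP qa.
- by apply: op_eq => x; rewrite -[in RHS]qq.
- exact: adj_eq.
Qed.

Lemma projection0 : projection 0.
Proof. by split; rewrite ?mulr0 ?adj0. Qed.

Lemma projection1 : projection 1.
Proof. by split; rewrite ?mulr1 ?adj1. Qed.

Lemma projectionB p q : projection p -> projection q -> p * q = q -> projection (p - q).
Proof.
move=> [pp pa] [qq qa] pq; split; last by rewrite adjB pa qa.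
have qp : q * p = q by rewrite -qa -[in LHS]pa -adjM pq.
by rewrite mulrBl !mulrBr pp pq qp qq subrr subr0.
Qed.

Lemma projectionD p q : projection p -> projection q -> p * q = 0 -> projection (p + q).
Proof.
move=> [pp pa] [qq qa] pq; split; last by rewrite adjD pa qa.
have qp : q * p = 0 by rewrite -qa -pa -adjM pq adj0.
by rewrite mulrDl !mulrDr pp pq qp qq addr0 add0r.
Qed.

Lemma partial_isometry_adj v : partial_isometry v -> partial_isometry (adj v).
Proof. by move=> pv; rewrite /partial_isometry -[in RHS]pv !adjM !adjK mulrA. Qed.

Lemma partial_isometry_proj v : partial_isometry v -> projection (adj v * v).
Proof.
move=> pv; split; last by rewrite adjM adjK.
by rewrite -mulrA (mulrA v) pv.
Qed.

Lemma partial_isometry_contraction v x : partial_isometry v -> hnorm (v x) <= hnorm x.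
Proof.
move=> /partial_isometry_proj[qq qa].
rewrite -(@ler_pXn2r _ 2)// ?nnegrE ?hnorm_ge0// -subr_ge0 -ler0c rmorphB /=.
rewrite -hdotE -adj_mul_hnorm -hdotBl -[X in X - _]op1E -opBE.
have -> : 1 - adj v * v = adj (1 - adj v * v) * (1 - adj v * v).
  rewrite adjB adj1 qa mulrBl mul1r mulrBr mulr1 qq.
  by rewrite subrr subr0.
exact: opos_sqr.
Qed.

(** The usual order on partial isometries: [w] restricts to [v] on the initial space of [v], and the
    remainder has orthogonal range, since the second equation says [adj (w - v) * v = 0]. Both
    equations pass to strong limits. *)
Definition extends v w := w * (adj v * v) = v /\ adj w * v = adj v * v.

Lemma extends_refl v : partial_isometry v -> extends v v.
Proof. by move=> pv; split; rewrite // mulrA. Qed.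

Lemma extends_trans v w z : partial_isometry v -> partial_isometry w ->
  extends v w -> extends w z -> extends v z.
Proof.
move=> pv pw [vw vw'] [wz wz'].
have qq : adj w * w * (adj v * v) = adj v * v by rewrite -mulrA vw.
split; first by rewrite -qq mulrA wz.
by rewrite -[in LHS]vw mulrA wz' qq.
Qed.

Lemma extends_proj v w : partial_isometry v -> partial_isometry w ->
  extends v w -> projection (adj w * w - adj v * v).
Proof.
move=> pv pw [vw vw'].
by apply: projectionB; [exact: partial_isometry_proj..|rewrite -mulrA vw].
Qed.

Lemma extends_proj_le p q : projection p -> projection q -> extends p q <-> q * p = p.
Proof.
move=> [pp pa] [qq qa]; rewrite /extends pa qa pp.
by split=> [[]|].
Qed.

(** Pythagoras, from [adj (w - v) * (w - v) = adj w * w - adj v * v]. It is the increment condition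
    of [monotone_strong_limit], with equality. *)
Lemma extends_hnorm v w x : extends v w ->
  hnorm (w x - v x) ^+ 2 = hnorm (w x) ^+ 2 - hnorm (v x) ^+ 2.
Proof.
move=> [_ vw]; apply: complexI; rewrite rmorphB /= -!adj_mul_hnorm -opBE -adj_mul_hnorm.
rewrite -hdotBl -opBE adjB mulrBl !mulrBr vw.
have -> : adj v * w = adj v * v by rewrite -[w]adjK -adjM vw adjM adjK.
by rewrite subrr subr0.
Qed.

Lemma partial_isometryD v w : partial_isometry v -> partial_isometry w ->
  adj v * w = 0 -> w * adj v = 0 ->
  [/\ partial_isometry (v + w), extends v (v + w) &
      adj (v + w) * (v + w) = adj v * v + adj w * w].
Proof.
move=> pv pw vw wv.
have wv' : adj w * v = 0 by rewrite -[v]adjK -adjM vw adj0.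
have vw' : v * adj w = 0 by rewrite -[v]adjK -adjM wv adj0.
have qE : adj (v + w) * (v + w) = adj v * v + adj w * w.
  by rewrite adjD mulrDl !mulrDr vw wv' addr0 add0r.
split=> //.
  rewrite /partial_isometry -mulrA qE mulrDl !mulrDr !mulrA pv pw vw' wv.
  by rewrite !mul0r addr0 add0r.
split; first by rewrite mulrDl !mulrA pv wv mul0r addr0.
by rewrite adjD mulrDl wv' addr0.
Qed.

End Projections.

(** The interface shared by [tau] on [M] and by the matrix trace on its amplification. It carries no
    normalisation, so that all corners of one algebra can be measured by a single trace. *)
Record finite_trace (R : realType) (H : hilbertSpace R) (L : set (H -> H))
    (T : op H -> R) : Prop := {
  finite_traceD : forall a b : op H, L a -> L b -> T (a + b) = T a + T b;
  finite_traceC : forall a b : op H, L a -> L b -> T (a * b) = T (b * a);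
  finite_trace_ge0 : forall q : op H, L q -> projection q -> 0 <= T q;
  finite_trace_faithful : forall q : op H, L q -> projection q -> T q = 0 -> q = 0
}.

Section TernaryPartialIsometry.
Variables (R : realType) (H : hilbertSpace R) (A : set (H -> H)).
Hypothesis vnA : von_neumann_algebra A.

Lemma ternary_partial_isometry (S : set (op H)) (a : op H) :
  S `<=` [set b : op H | A b] -> ternary S -> S a -> a <> 0 ->
  exists v, [/\ S v, partial_isometry v & v <> 0].
Proof.
move=> SA tS Sa a0; have [k k0 ka] := op_bound a.
have k1 : 0 < k + 1 by rewrite ltr_wpDl.
(* Dividing by [k + 1], which is positive even if [k = 0], makes [a] a contraction. *)
have [] := @newton_schulz_partial_isometry _ _ _ vnA (((k + 1)^-1)%:C *: a) _ S SA tS.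
- move=> x; rewrite opZE -lecR hnormZ ger0_norm ?ler0c ?invr_ge0 ?(ltW k1)//.
  rewrite -rmorphM lecR mulrC ler_pdivrMr//; apply: le_trans (ka x) _.
  by rewrite mulrC ler_wpM2l ?hnorm_ge0// lerDl.
- exact: ternaryZ.
move=> v [Sv pv] av; exists v; split=> // v0; apply: a0; apply: op_eq => x.
apply/eqP; have := av x; rewrite v0 op0E hnorm0 opZE => h.
have : hnorm (((k + 1)^-1)%:C *: a x) == 0 by rewrite eq_le h hnorm_ge0.
rewrite hnorm_eq0 scaler_eq0 => /orP[|//].
by rewrite fmorph_eq0 invr_eq0 gt_eqF.
Qed.

End TernaryPartialIsometry.

(** * Maximality, primeness of factors, and comparison *)

Section Comparison.
Variables (R : realType) (H : hilbertSpace R) (L : set (H -> H)) (T : op H -> R).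
Hypotheses (vnL : von_neumann_algebra L) (L1 : L idfun) (trT : finite_trace L T).
Implicit Types (a p q v w : op H) (S : set (op H)).

Lemma in_one : L (1 : op H). Proof. exact: L1. Qed.

Lemma traceB p q : L p -> L q -> T (p - q) = T p - T q.
Proof.
move=> Lp Lq; apply/eqP; rewrite eq_sym subr_eq -(finite_traceD trT)//.
  by rewrite subrK.
exact: vnaB.
Qed.

Lemma trace0 : T 0 = 0.
Proof. by rewrite -(subrr (1 : op H)) traceB ?subrr//; exact: in_one. Qed.

Lemma trace_le p q : L p -> L q -> projection p -> projection q -> p * q = q -> T q <= T p.
Proof.
move=> Lp Lq pp pq e; rewrite -subr_ge0 -traceB//.
by apply: (finite_trace_ge0 trT); [exact: vnaB|exact: projectionB].
Qed.

Lemma trace_gt0 q : L q -> projection q -> q <> 0 -> 0 < T q.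
Proof.
move=> Lq pq q0; rewrite lt_def (finite_trace_ge0 trT)// andbT.
by apply/eqP => /(finite_trace_faithful trT Lq pq).
Qed.

Lemma extends_trace v w : L v -> L w -> partial_isometry v -> partial_isometry w ->
  extends v w -> T (adj v * v) <= T (adj w * w).
Proof.
move=> Lv Lw pv pw vw.
have LM a : L a -> L (adj a * a) by move=> La; apply: vnaM => //; exact: vna_adj.
rewrite -subr_ge0 -traceB; [|exact: LM..].
apply: (finite_trace_ge0 trT); last exact: extends_proj.
by apply: vnaB; [|exact: LM..].
Qed.

(** For fixed [n] the products [u k * (adj (u n) * u n)] and [adj (u n) * u k] are constant from
    [k = n] on, so the equations of [extends] pass to the strong limit, which is then a partial
    isometry. *)
Lemma partial_isometry_chain S (u : nat -> op H) :
  S `<=` [set a : op H | L a] -> ternary S ->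
  (forall n, S (u n)) -> (forall n, partial_isometry (u n)) ->
  (forall n, extends (u n) (u n.+1)) ->
  exists v, [/\ S v, partial_isometry v, forall n, extends (u n) v &
    forall x, hcvg (fun n => u n x) (v x)].
Proof.
move=> SL tS Su pu incr.
have mono k l : (k <= l)%N -> extends (u k) (u l).
  elim: l => [|l IH]; first by rewrite leqn0 => /eqP->; exact: extends_refl.
  rewrite leq_eqVlt => /orP[/eqP->|/IH kl]; first exact: extends_refl.
  exact: extends_trans (incr l).
have umono k l x : (k <= l)%N ->
    hnorm (u l x - u k x) ^+ 2 <= hnorm (u l x) ^+ 2 - hnorm (u k x) ^+ 2.
  by move=> /mono/extends_hnorm ->.
have [v Lv uv] := monotone_strong_limit vnL (fun n => SL _ (Su n))
  (fun n x => partial_isometry_contraction x (pu n)) umono.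
have vq n : v * (adj (u n) * u n) = u n.
  apply: op_eq => x; apply: (hcvg_unique (uv _)); apply: (@hcvg_const _ _ _ _ n) => k nk.
  by rewrite -opME; have [->] := mono _ _ nk.
have uv' n : adj (u n) * v = adj (u n) * u n.
  apply: op_eq => x; apply: (hcvg_unique (op_hcvg (adj (u n)) (uv x))).
  apply: (@hcvg_const _ _ _ _ n) => k nk; rewrite /comp -opME.
  have [_ e] := mono _ _ nk.
  by rewrite -[adj (u n) * u k]adjK adjM adjK e adjM adjK.
have vu n : adj v * u n = adj (u n) * u n.
  by rewrite -[adj v * u n]adjK adjM adjK uv' adjM adjK.
exists v; split=> //; first exact: (ternary_closed tS Su).
  apply: op_eq => x; apply: (hcvg_unique (op_hcvg (v * adj v) (uv x))) => e e0.
  have [N NP] := uv x e e0; exists N => n /NP.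
  by rewrite /comp -opME -mulrA vu vq.
Qed.

(** Maximality is measured by [T (adj v * v)]. If some compressed element were nonzero, the elements
    of [S] orthogonal to [v] on both sides would form a nonzero ternary space, hence contain a
    nonzero partial isometry [w], and [v + w] would have larger trace by faithfulness. *)
Lemma maximal_partial_isometry S :
  S `<=` [set a : op H | L a] -> ternary S -> S 0 ->
  exists v, [/\ S v, partial_isometry v &
    forall a, S a -> (1 - v * adj v) * a * (1 - adj v * v) = 0].
Proof.
move=> SL tS S0.
pose P v := S v /\ partial_isometry v.
have [] := @brezis_browder R (op H) P (@extends R H) (fun v => T (adj v * v)) (T 1) 0.
- by split=> //; rewrite /partial_isometry mulr0.
- by move=> v [_ /extends_refl].
- by move=> x y z [_ px] [_ py] _; exact: extends_trans.
- by move=> x y [/SL Lx px] [/SL Ly py]; exact: extends_trace.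
- move=> v [/SL Lv pv]; apply: trace_le; [exact: in_one| |exact: projection1| |].
  + by apply: vnaM => //; exact: vna_adj.
  + exact: partial_isometry_proj.
  + by rewrite mul1r.
- move=> u Pu incr.
  have [v [Sv pv uv _]] :=
    partial_isometry_chain SL tS (fun n => (Pu n).1) (fun n => (Pu n).2) incr.
  by exists v.
move=> v [Sv pv] vmax; exists v; split=> // a Sa.
pose S' := [set b | [/\ S b, adj v * b = 0 & b * adj v = 0]].
have tS' : ternary S'.
  split.
  - move=> b c [Sb vb bv] [Sc vc cv]; split; first exact: ternaryD.
      by rewrite mulrDr vb vc addr0.
    by rewrite mulrDl bv cv addr0.
  - move=> s b [Sb vb bv]; split; first exact: ternaryZ.
      by rewrite -op_scalerAr vb scaler0.
    by rewrite -op_scalerAl bv scaler0.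
  - move=> b c d [Sb vb bv] [Sc vc cv] [Sd vd dv]; split; first exact: ternaryM.
      by rewrite !mulrA vb !mul0r.
    by rewrite -mulrA dv mulr0.
  - move=> u b Su ub; split.
    + by apply: (ternary_closed tS _ ub) => k; case: (Su k).
    + apply: op_eq => x; apply: (hcvg_unique (op_hcvg (adj v) (ub x))).
      apply: (@hcvg_const _ _ _ _ 0%N) => n _ /=.
      by case: (Su n) => _ e _; rewrite -opME e.
    + apply: op_eq => x; apply: (hcvg_unique (ub (adj v x))).
      by apply: (@hcvg_const _ _ _ _ 0%N) => n _; case: (Su n) => _ _ e; rewrite -opME e.
have [//|/eqP a0] := eqVneq ((1 - v * adj v) * a * (1 - adj v * v)) 0.
have Sa' : S' ((1 - v * adj v) * a * (1 - adj v * v)).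
  have vv : adj v * v * adj v = adj v by rewrite -mulrA -[RHS](partial_isometry_adj pv) adjK mulrA.
  have SN b : S b -> S (- b) by rewrite -scaleN1r; exact: ternaryZ.
  split.
  (* The unit need not lie in [S]; once the product is expanded, every term is built from [a] and
     [v] by ternary products. *)
  - rewrite mulrBl mul1r mulrBr mulr1 !mulrBl.
    have h1 : S (v * adj v * a) by exact: ternaryM.
    have h2 b : S b -> S (b * (adj v * v)) by move=> Sb; rewrite mulrA; exact: ternaryM.
    apply: (ternaryD tS); first by apply: (ternaryD tS) => //; exact: SN.
    apply/SN; apply: (ternaryD tS); first exact: h2.
    exact/SN/h2.
  - by rewrite !mulrA [adj v * (1 - _)]mulrBr mulr1 mulrA vv subrr !mul0r.
  - by rewrite -!mulrA [(1 - _) * adj v]mulrBl mul1r vv subrr !mulr0.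
have S'L : S' `<=` [set a : op H | L a] by move=> b [/SL].
have [w [[Sw vw wv] pw w0]] := ternary_partial_isometry vnL S'L tS' Sa' a0.
have [pvw ext q] := partial_isometryD pv pw vw wv.
have := vmax (v + w) (conj (ternaryD tS Sv Sw) pvw) ext.
have Lq b : S b -> L (adj b * b) by move=> /SL Lb; apply: vnaM => //; exact: vna_adj.
rewrite q (finite_traceD trT); [|exact: Lq..].
rewrite gerDl leNgt trace_gt0//; first exact: Lq.
  exact: partial_isometry_proj.
by move=> /adj_mul_eq0.
Qed.

(** A strongly closed right ideal has a left unit, namely a projection [q] of largest trace. If
    [a - q * a] were nonzero, the elements of [S] killed by [q] would contain a nonzero partial
    isometry [w], and [q + w * adj w] would be larger. *)
Lemma maximal_projection S :
  S `<=` [set a : op H | L a] -> ternary S -> S 0 ->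
  (forall a b : op H, S a -> L b -> S (a * b)) ->
  exists q, [/\ S q, projection q & forall a, S a -> q * a = a].
Proof.
move=> SL tS S0 SM.
pose P q := S q /\ projection q.
have pP q : projection q -> partial_isometry q.
  by move=> [qq qa]; rewrite /partial_isometry qa !qq.
have [] := @brezis_browder R (op H) P (@extends R H) (fun v => T (adj v * v)) (T 1) 0.
- by split=> //; exact: projection0.
- by move=> v [_ /pP/extends_refl].
- by move=> x y z [_ /pP px] [_ /pP py] _; exact: extends_trans.
- by move=> x y [/SL Lx /pP px] [/SL Ly /pP py]; exact: extends_trace.
- move=> v [/SL Lv [vv va]]; rewrite va vv; apply: trace_le => //; first exact: projection1.
  by rewrite mul1r.
- move=> u Pu incr.
  have [v [Sv pv uv ucvg]] :=
    partial_isometry_chain SL tS (fun n => (Pu n).1) (fun n => pP _ (Pu n).2) incr.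
  exists v => //; split=> //.
  have limE a : (forall n, a * u n = u n) -> a * v = v.
    move=> au; apply: op_eq => x; apply: (hcvg_unique (op_hcvg a (ucvg x))).
    by have := ucvg x; congr hcvg; apply/funext => n; rewrite /comp -opME au.
  have qE n : adj (u n) * u n = u n by have [_ [uu ua]] := Pu n; rewrite ua.
  have vv : v * v = v by apply: limE => n; rewrite -[X in v * X](qE n); case: (uv n).
  have vav : adj v * v = v by apply: limE => n; rewrite -[RHS]qE; case: (uv n).
  by split=> //; rewrite -[in LHS]vav adjM adjK.
move=> q [Sq [qq qa]] qmax; exists q; split=> // a Sa.
pose S' := [set b | S b /\ q * b = 0].
have tS' : ternary S'.
  split.
  - by move=> b c [Sb qb] [Sc qc]; split; [exact: ternaryD|rewrite mulrDr qb qc addr0].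
  - by move=> s b [Sb qb]; split; [exact: ternaryZ|rewrite -op_scalerAr qb scaler0].
  - by move=> b c d [Sb qb] [Sc qc] [Sd qd]; split; [exact: ternaryM|rewrite !mulrA qb !mul0r].
  - move=> u b Su ub; split.
      by apply: (ternary_closed tS _ ub) => k; case: (Su k).
    apply: op_eq => x; apply: (hcvg_unique (op_hcvg q (ub x))).
    by apply: (@hcvg_const _ _ _ _ 0%N) => n _ /=; case: (Su n) => _ e; rewrite -opME e.
have [|/eqP a0] := eqVneq (a - q * a) 0; first by move/subr0_eq.
have SN b : S b -> S (- b) by rewrite -scaleN1r; exact: ternaryZ.
have Sa' : S' (a - q * a).
  split; last by rewrite mulrBr mulrA qq subrr.
  by apply: (ternaryD tS) => //; apply/SN/SM => //; exact: SL.
have S'L : S' `<=` [set a : op H | L a] by move=> b [/SL].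
have [w [[Sw qw] pw w0]] := ternary_partial_isometry vnL S'L tS' Sa' a0.
have Lw := SL _ Sw; have Lq := SL _ Sq.
have Sww : S (w * adj w) by apply: SM => //; exact: vna_adj.
have pww : projection (w * adj w).
  by have := partial_isometry_proj (partial_isometry_adj pw); rewrite adjK.
have pqw : projection (q + w * adj w) by apply: projectionD => //; rewrite mulrA qw mul0r.
have := qmax _ (conj (ternaryD tS Sq Sww) pqw).
have -> : adj (q + w * adj w) * (q + w * adj w) = q + w * adj w.
  by case: pqw => e1 e2; rewrite e2.
rewrite qa qq (finite_traceD trT)//; last exact: SL.
rewrite gerDl leNgt trace_gt0//; first last.
- by rewrite -[w in w * _]adjK => /adj_mul_eq0 e; apply: w0; rewrite -[w]adjK e adj0.
- exact: SL.
move=> h; exfalso; apply: notF; apply: h; apply/extends_proj_le => //.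
by rewrite mulrDl qq -mulrA -[q in adj w * q]qa -adjM qw adj0 mulr0 addr0.
Qed.

(** The elements [m] with [m L b = 0] form a strongly closed two-sided ideal, whose unit [q] is
    central, hence scalar. If [a] is nonzero then so is [q], the scalar is 1, and the identity
    itself lies in the ideal, which gives [b = 0]. *)
Lemma factor_prime : is_factor L ->
  forall a b : op H, L a -> L b -> (forall m : op H, L m -> a * m * b = 0) -> a = 0 \/ b = 0.
Proof.
move=> [_ _ _ center] a b La Lb ab.
pose J := [set m : op H | L m /\ forall x : op H, L x -> m * x * b = 0].
have JL : J `<=` [set a : op H | L a] by move=> m [].
have JM (m y : op H) : J m -> L y -> J (m * y).
  move=> [Lm mb] Ly; split; first exact: vnaM.
  by move=> x Lx; rewrite -(mulrA m); apply: mb; exact: vnaM.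
have MJ (m y : op H) : J m -> L y -> J (y * m).
  move=> [Lm mb] Ly; split; first exact: vnaM.
  by move=> x Lx; rewrite -!mulrA (mulrA m) mb// mulr0.
have tJ : ternary J.
  split.
  - move=> m m' [Lm mb] [Lm' mb']; split; first exact: vnaD.
    by move=> x Lx; rewrite !mulrDl mb// mb'// addr0.
  - move=> s m [Lm mb]; split; first exact: vnaZ.
    by move=> x Lx; rewrite -!op_scalerAl mb// scaler0.
  - move=> m y z Jm [Ly _] [Lz _]; rewrite -mulrA; apply: JM => //.
    by apply: vnaM => //; exact: vna_adj.
  - move=> u m Ju um; split.
      apply: (vna_pointwise_closed vnL _ (fun k => (Ju k).1) um).
      by case: (opP m).
    move=> x Lx; apply: op_eq => z; rewrite !opME; apply: (hcvg_unique (um _)).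
    by apply: (@hcvg_const _ _ _ _ 0%N) => n _; case: (Ju n) => _ /(_ x Lx) e; rewrite -!opME e.
have J0 : J 0 by split; [exact: vna0|move=> x _; rewrite !mul0r].
have [q [Jq [qq qa] qJ]] := maximal_projection JL tJ J0 JM.
have qcentral (m : op H) : L m -> q * m = m * q.
  move=> Lm; rewrite -(qJ (m * q)); last exact: MJ.
  have := qJ _ (MJ _ _ Jq (vna_adj vnL Lm)) => /(congr1 (@adj _ _)).
  by rewrite !adjM adjK qa mulrA => ->.
have [s qs] : exists s : R[i], op_fun q = s *: (idfun : H -> H).
  apply: center; first by case: Jq.
  move=> g Lg; have [m mg] := vna_op vnL Lg.
  by rewrite -mg; have /(congr1 (@op_fun R H)) := qcentral m (eq_ind_r L Lg mg).
have [a0|a0] := pselect (a = 0); [by left|right].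
have qE : q = s *: (1 : op H) by apply: op_eq => x; rewrite opZE op1E qs.
have s1 : s = 1.
  have sq : s *: q = q by rewrite -[RHS]qq {2}qE -op_scalerAl mul1r.
  apply/eqP; rewrite -subr_eq0.
  have : (s - 1) *: q = 0 by rewrite scalerBl scale1r sq subrr.
  move=> h; have [//|s1] := eqVneq (s - 1) 0; case: a0.
  have q0 : q = 0 by rewrite -[q](scalerK s1) h scaler0.
  by rewrite -(qJ a) ?q0 ?mul0r.
case: Jq => _ /(_ 1 in_one).
by rewrite qE s1 scale1r !mul1r.
Qed.

(** Factoriality in the form that passes to matrix algebras entry by entry, without computing a
    centre. *)
Definition prime_vna := forall a b : op H, L a -> L b ->
  (forall m : op H, L m -> a * m * b = 0) -> a = 0 \/ b = 0.

(** A maximal partial isometry [v] of [f L r] leaves [(f - v * adj v) L (r - adj v * v) = 0], and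
    primeness makes one of the two remainders vanish. *)
Lemma comparison : prime_vna -> forall f r : op H, L f -> L r -> projection f -> projection r ->
  exists v : op H, [/\ L v, partial_isometry v, f * v = v, v * r = v &
    adj v * v = r \/ v * adj v = f].
Proof.
move=> primeL f r Lf Lr [ff fa] [rr ra].
pose S := [set a : op H | [/\ L a, f * a = a & a * r = a]].
have SL : S `<=` [set a : op H | L a] by move=> a [].
have tS : ternary S.
  split.
  - move=> a b [La fa' ar] [Lb fb br]; split; first exact: vnaD.
      by rewrite mulrDr fa' fb.
    by rewrite mulrDl ar br.
  - move=> s a [La fa' ar]; split; first exact: vnaZ.
      by rewrite -op_scalerAr fa'.
    by rewrite -op_scalerAl ar.
  - move=> a b c [La fa' ar] [Lb fb br] [Lc fc cr]; split.
    + by do 2?apply: vnaM => //; exact: vna_adj.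
    + by rewrite !mulrA fa'.
    + by rewrite -mulrA cr.
  - move=> u b Su ub; split.
    + apply: (vna_pointwise_closed vnL _ (fun k => SL _ (Su k)) ub).
      by case: (opP b).
    + apply: op_eq => x; apply: (hcvg_unique (op_hcvg f (ub x))).
      by have := ub x; congr hcvg; apply/funext => n; case: (Su n) => _ e _; rewrite /comp -opME e.
    + apply: op_eq => x; apply: (hcvg_unique (ub (r x))).
      by have := ub x; congr hcvg; apply/funext => n; case: (Su n) => _ _ e; rewrite -opME e.
have S0 : S 0 by split; [exact: vna0|rewrite mulr0|rewrite mul0r].
have [v [[Lv fv vr] pv vmax]] := maximal_partial_isometry SL tS S0.
have Lv' := vna_adj vnL Lv.
exists v; split=> //.
have [||m Lm|h|h] := primeL (f - v * adj v) (r - adj v * v).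
- by apply: vnaB => //; exact: vnaM.
- by apply: vnaB => //; exact: vnaM.
- have <- : (1 - v * adj v) * (f * m * r) * (1 - adj v * v) =
      (f - v * adj v) * m * (r - adj v * v).
    have -> : f - v * adj v = (1 - v * adj v) * f.
      by rewrite mulrBl mul1r -mulrA -[f in adj v * f]fa -adjM fv.
    have -> : r - adj v * v = r * (1 - adj v * v).
      by rewrite mulrBr mulr1 mulrA -[r in r * adj v]ra -adjM vr.
    by rewrite !mulrA.
  apply: vmax; split; first by do 2?apply: vnaM.
    by rewrite !mulrA ff.
  by rewrite -mulrA rr.
- by right; exact/esym/subr0_eq.
- by left; exact/esym/subr0_eq.
Qed.

End Comparison.

(** * Corners *)

Lemma complex_norm_eps_eq0 (R : realType) (z : R[i]) :
  (forall e : R, 0 < e -> `|z| <= e%:C) -> z = 0.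
Proof.
move=> ze; have [r rE] : exists r : R, `|z| = r%:C.
  by exists (complex.Re `|z|); apply/esym; rewrite RRe_real ?ger0_real.
apply/eqP; rewrite -normr_eq0 rE; apply/eqP; congr _%:C; apply/le_anti.
rewrite -ler0c -rE normr_ge0 andbT.
by apply/ler_addgt0Pr => e /ze; rewrite add0r rE lecR.
Qed.

Lemma mem_big_cat (I S : eqType) (r : seq I) (P : pred I) (F : I -> seq S) i y :
  i \in r -> P i -> y \in F i -> y \in \big[cat/[::]]_(i <- r | P i) F i.
Proof.
move=> + Pi yi; elim: r => // j r IH; rewrite in_cons big_cons => /orP[/eqP<-|/IH h].
  by rewrite Pi mem_cat yi.
by case: ifP => // _; rewrite mem_cat h orbT.
Qed.

Lemma big_cat_ind (I S : eqType) (r : seq I) (P : pred I) (F : I -> seq S) (Q : S -> Prop) :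
  (forall i, i \in r -> P i -> forall y, y \in F i -> Q y) ->
  forall y, y \in \big[cat/[::]]_(i <- r | P i) F i -> Q y.
Proof.
move=> h; rewrite big_seq_cond; elim/big_ind: _ => [y|s s' IH IH' y|i /andP[ir Pi]].
- by rewrite in_nil.
- by rewrite mem_cat => /orP[/IH|/IH'].
- exact: h.
Qed.

Lemma size_big_cat (I S : Type) (r : seq I) (P : pred I) (F : I -> seq S) :
  size (\big[cat/[::]]_(i <- r | P i) F i) = (\sum_(i <- r | P i) size (F i))%N.
Proof. exact: (big_morph size (@size_cat S)). Qed.

Section Corner.
Variables (R : realType) (H : hilbertSpace R) (L : set (H -> H)).
Hypotheses (vnL : von_neumann_algebra L).
Variable e : op H.
Hypotheses (Le : L e) (pe : projection e).
Implicit Types (a b u v w : op H).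

Lemma cornerP a : corner L e a <-> [/\ L a, e * a = a & a * e = a].
Proof.
case: pe => ee _; split=> [[g Lg ga]|[La ea ae]]; last first.
  by exists a => //; apply/funext => x; rewrite /= -[in RHS]ae -[in RHS]ea.
have [b bg] := vna_op vnL Lg; rewrite -bg in ga Lg.
have -> : a = e * b * e by apply: op_eq => x; rewrite -ga.
split; first by do 2?apply: vnaM.
  by rewrite !mulrA ee.
by rewrite -mulrA ee.
Qed.

Lemma corner_sub : corner L e `<=` L.
Proof. by move=> _ [g Lg <-]; do 2?apply: (vna_mul vnL) => //. Qed.

Lemma corner_op g : corner L e g -> exists2 a : op H, op_fun a = g & [/\ L a, e * a = a & a * e = a].
Proof.
move=> cg; have [a ag] := vna_op vnL (corner_sub cg).
by exists a => //; apply/cornerP; rewrite ag.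
Qed.

Lemma corner_vna : von_neumann_algebra (corner L e).
Proof.
split.
- by move=> g /corner_sub/(vna_bounded vnL).
- apply/(cornerP 0); split; [exact: vna0|by rewrite mulr0|by rewrite mul0r].
- move=> s _ _ /corner_op[a <- [La ea ae]] /corner_op[b <- [Lb eb be]].
  have -> : s *: op_fun a + op_fun b = op_fun (s *: a + b).
    by apply/funext => x; rewrite opDE opZE.
  apply/cornerP; split; first by apply: vnaD => //; exact: vnaZ.
    by rewrite mulrDr -op_scalerAr ea eb.
  by rewrite mulrDl -op_scalerAl ae be.
- move=> _ _ /corner_op[a <- [La ea ae]] /corner_op[b <- [Lb eb be]].
  apply/(cornerP (a * b)); split; first exact: vnaM.
    by rewrite mulrA ea.
  by rewrite -mulrA be.
- move=> _ /corner_op[a <- [La ea ae]]; exists (adj a); last by move=> x y; rewrite adjP.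
  case: pe => _ ead; apply/cornerP; split; first exact: vna_adj.
    by rewrite -[e in e * _]ead -adjM ae.
  by rewrite -[e in _ * e]ead -adjM ea.
- move=> g [bg cg].
  have Lg : L g.
    apply: (vna_closed vnL); split=> // s d d0.
    by have [h /corner_sub Lh hs] := cg s d d0; exists h.
  have [a ag] := vna_op vnL Lg; rewrite -ag in bg cg Lg *.
  case: pe => ee ead.
  suff eae : e * a * e = a.
    by apply/cornerP; split=> //; rewrite -eae ?mulrA ?ee// -!mulrA ee.
  apply: op_eq => x; apply: hdot_inj => y; apply/eqP; rewrite -subr_eq0; apply/eqP.
  apply: complex_norm_eps_eq0 => d d0; have d20 : 0 < d / 2 by rewrite divr_gt0.
  (* Since [b = e * b * e], both pairs give [b] the same coefficient; hence the coefficients of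
     [e * a * e] and [a] at [x], [y] differ by at most [d]. *)
  have [_ /corner_op[b <- [Lb eb be]] bs] := cg [:: (x, y); (e x, e y)] _ d20.
  have := bs x y; rewrite !in_cons eqxx => /(_ isT) h1.
  have := bs (e x) (e y); rewrite !in_cons eqxx orbT => /(_ isT) h2.
  have -> : hdot ((e * a * e) x) y - hdot (a x) y =
      hdot ((op_fun a - op_fun b) (e x)) (e y) - hdot ((op_fun a - op_fun b) x) y.
    have eP z : hdot (e z) y = hdot z (e y) by rewrite adjP ead.
    rewrite !opME eP !hdotBl -[hdot (b (e x)) (e y)]eP -!opME eb be.
    by rewrite opprB addrA subrK.
  apply: le_trans (ler_normB _ _) _; rewrite [d]splitr rmorphD.
  by apply/lerD; exact: ltW.
Qed.

End Corner.

(** * Moving generators from one corner to another *)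

Section CornerGeneration.
Variables (R : realType) (H : hilbertSpace R) (L : set (H -> H)).
Hypotheses (vnL : von_neumann_algebra L).
Implicit Types (a b u v w : op H).

Lemma vna_sum_seq (A : set (H -> H)) (I : eqType) (r : seq I) (F : I -> op H) :
  von_neumann_algebra A ->
  (forall i, i \in r -> A (F i)) -> A (\sum_(i <- r) F i).
Proof.
move=> vnA AF; rewrite big_seq; elim/big_ind: _ => //; first exact: vna0.
by move=> a b; exact: vnaD.
Qed.

(** The elements [a] of [e L e] all of whose blocks [u * a * adj v] lie in [B] form a von Neumann
    algebra [D] containing [X], so [D] is all of [e L e]. The piece [u0] with [u0 * adj u0 = f1]
    then gives [f1 L f1], and [f1] together with the [w] expands any element of [f L f] into blocks
    from [f1 L f1]. *)
Lemma corner_generation (e f f1 : op H) (us ws : seq (op H)) (X B : set (H -> H)) :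
  L e -> L f -> projection e -> projection f -> projection f1 ->
  (forall u, u \in us -> [/\ L u, f1 * u = u & u * e = u]) ->
  \sum_(u <- us) adj u * u = e ->
  (exists2 u, u \in us & u * adj u = f1) ->
  (forall w, w \in ws -> L w /\ f1 * w = w) ->
  f1 + \sum_(w <- ws) adj w * w = f -> X `<=` corner L e -> generated_vna X = corner L e ->
  von_neumann_algebra B ->
  (forall a u v, X a -> u \in us -> v \in us -> B (u * a * adj v)) ->
  (forall w, w \in ws -> B w) -> corner L f `<=` B.
Proof.
move=> Le Lf pe pf pf1 usP us_sum [u0 u0s u0f1] wsP ws_sum Xe genX vnB BX Bw.
have cvna := corner_vna vnL Le pe.
pose D := [set g | exists a : op H, [/\ op_fun a = g, corner L e a &
  forall u v, u \in us -> v \in us -> B (u * a * adj v)]].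
have vnD : von_neumann_algebra D.
  split.
  - by move=> _ [a [<- _ _]]; case: (opP a).
  - exists 0; split=> //; first exact: vna0.
    by move=> u v _ _; rewrite mulr0 mul0r; exact: vna0.
  - move=> s _ _ [a [<- ca Ba]] [b [<- cb Bb]]; exists (s *: a + b); split.
    + by apply/funext => x; rewrite opDE opZE.
    + by apply: vnaD => //; exact: vnaZ.
    + move=> u v us_u us_v; rewrite mulrDr mulrDl; apply: vnaD => //; last exact: Bb.
      by rewrite -op_scalerAr -op_scalerAl; apply: vnaZ => //; exact: Ba.
  - move=> _ _ [a [<- ca Ba]] [b [<- cb Bb]]; exists (a * b); split=> //; first exact: vnaM.
    move=> u v us_u us_v; have [_ _ ae] := (cornerP vnL Le pe a).1 ca.
    (* Inserting [e], the sum of the [adj w * w], between [a] and [b] writes a block of the product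
       as a sum of products of blocks. *)
    rewrite -ae -us_sum mulr_sumr mulr_suml mulr_sumr mulr_suml.
    apply: vna_sum_seq => // w us_w.
    have -> : u * (a * (adj w * w) * b) * adj v = (u * a * adj w) * (w * b * adj v).
      by rewrite !mulrA.
    by apply: vnaM => //; [exact: Ba|exact: Bb].
  - move=> _ [a [<- ca Ba]]; exists (adj a); last by move=> x y; rewrite adjP.
    exists (adj a); split=> //; first exact: vna_adj.
    move=> u v us_u us_v; have := vna_adj vnB (Ba v u us_v us_u).
    by rewrite !adjM adjK mulrA.
  - move=> g [bg Dg].
    have cg : corner L e g.
      apply: (vna_closed cvna); split=> // s d d0.
      by have [_ [b [<- cb _]] bs] := Dg s d d0; exists b.
    have [a ag _] := corner_op vnL Le pe cg; rewrite -ag in bg Dg cg *.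
    exists a; split=> // u v us_u us_v; apply: (vna_closed vnB); split.
      by case: (opP (u * a * adj v)).
    move=> s d d0.
    (* Testing [u * b * adj v] at [x], [y] is testing [b] at [adj v x], [adj u y]. *)
    have [_ [b [<- cb Bb]] bs] := Dg [seq (adj v z.1, adj u z.2) | z <- s] d d0.
    exists (u * b * adj v); first exact: Bb.
    move=> x y xy.
    have := bs _ _ (map_f (fun z => (adj v z.1, adj u z.2)) xy).
    congr (`|_| < _); rewrite /= !hdotBl.
    by rewrite /comp !adjP.
have De : corner L e `<=` D.
  rewrite -genX => g; apply=> // h Xh.
  have [a ah _] := corner_op vnL Le pe (Xe _ Xh).
  exists a; split=> //; first by rewrite ah; exact: Xe.
  by move=> u v; apply: BX; rewrite ah.
have [ee ea] := pe; have [ff fa] := pf; have [f11 f1a] := pf1.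
have Bf1 a : L a -> f1 * a = a -> a * f1 = a -> B a.
  move=> La f1a' af1; have [Lu0 _ u0e] := usP _ u0s.
  have -> : a = u0 * (adj u0 * a * u0) * adj u0.
    by rewrite -{1}f1a' -{1}af1 -u0f1 !mulrA.
  have [|b [/val_inj -> _]] := De (adj u0 * a * u0); last by apply.
  apply/(cornerP vnL Le pe); split.
  - by do 2?apply: vnaM => //; exact: vna_adj.
  - by rewrite !mulrA -[e in e * adj u0]ea -adjM u0e.
  - by rewrite -mulrA u0e.
have Lf1 : L f1 by have [Lu0 _ _] := usP _ u0s; rewrite -u0f1; apply: vnaM => //; exact: vna_adj.
pose vs := f1 :: ws.
have vsP v : v \in vs -> [/\ L v, f1 * v = v & B v].
  rewrite in_cons => /orP[/eqP->|vw]; first by split=> //; exact: Bf1.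
  by have [Lv f1v] := wsP _ vw; split=> //; exact: Bw.
have vs_sum : \sum_(v <- vs) adj v * v = f by rewrite big_cons f1a f11.
move=> _ /(corner_op vnL Lf pf)[a <- [La fa' af]].
rewrite -fa' -af -vs_sum mulr_suml.
apply: vna_sum_seq => // v vv; rewrite mulr_sumr mulr_sumr; apply: vna_sum_seq => // w vw.
have [[Lv f1v Bv] [Lw f1w Bw']] := (vsP _ vv, vsP _ vw).
have -> : adj v * v * (a * (adj w * w)) = adj v * (v * a * adj w) * w by rewrite !mulrA.
apply: vnaM => //; apply: vnaM => //; first exact: vna_adj.
apply: Bf1; first by do 2?apply: vnaM => //; exact: vna_adj.
  by rewrite !mulrA f1v.
by rewrite -!mulrA -[f1 in adj w * f1]f1a -adjM f1w.
Qed.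

End CornerGeneration.

(** * Cutting a projection into pieces of bounded trace *)

Section Subdivision.
Variables (R : realType) (H : hilbertSpace R) (L : set (H -> H)) (T : op H -> R).
Hypotheses (vnL : von_neumann_algebra L) (L1 : L idfun) (trT : finite_trace L T).
Hypothesis primeL : prime_vna L.
Implicit Types (a b d e f p q r u v w : op H).

Lemma trace_initial v : L v -> T (adj v * v) = T (v * adj v).
Proof. by move=> Lv; apply: (finite_traceC trT) => //; exact: vna_adj. Qed.

Lemma trace_initial_le v r : L v -> L r -> partial_isometry v -> projection r -> v * r = v ->
  T (adj v * v) <= T r.
Proof.
move=> Lv Lr pv pr vr; apply: (trace_le vnL trT) => //.
- by apply: vnaM => //; exact: vna_adj.
- exact: partial_isometry_proj.
- by case: pr => _ ra; rewrite mulrA -{1}ra -adjM vr.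
Qed.

Lemma trace_final_le v f : L v -> L f -> partial_isometry v -> projection f -> f * v = v ->
  T (v * adj v) <= T f.
Proof.
move=> Lv Lf pv pf fv; rewrite -{1}[v]adjK; apply: trace_initial_le => //.
- exact: vna_adj.
- exact: partial_isometry_adj.
- by case: pf => _ fa; rewrite -fa -adjM fv.
Qed.

Definition orthogonal_pieces := pairwise
  [rel u v : op H | (adj u * u) * (adj v * v) == 0].

(** Comparison peels copies of [f] off [q] as long as possible; each copy lowers the trace by [T f],
    so induction on a strict bound for [T q / T f] terminates. Only the last piece can have a range
    smaller than [f], whence the count; and if [T q > T f] the first piece already has range [f]. *)
Lemma subdivide f q : L f -> projection f -> 0 < T f -> L q -> projection q ->
  exists us : seq (op H),
    [/\ forall u, u \in us -> [/\ L u, partial_isometry u, f * u = u, u * q = u & u <> 0],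
        orthogonal_pieces us,
        \sum_(u <- us) adj u * u = q,
        (size us)%:R * T f <= T q + T f &
        T q <= T f \/ exists2 u, u \in us & u * adj u = f].
Proof.
move=> Lf pf f0; have [N] : exists N, T q < N%:R * T f.
  exists (Num.truncn (T q / T f)).+1; rewrite -ltr_pdivrMr//; exact: truncnS_gt.
elim: N q => [|N IH] q qN Lq pq.
  by have := finite_trace_ge0 trT Lq pq; rewrite leNgt -(mul0r (T f)) qN.
have Tq := finite_trace_ge0 trT Lq pq.
have [->|/eqP q0] := eqVneq q 0.
  exists [::]; split=> //; first by rewrite big_nil.
    by rewrite mul0r (trace0 vnL L1 trT) add0r ltW.
  by left; rewrite (trace0 vnL L1 trT) ltW.
have [v [Lv pv fv vq [vvq|vvf]]] := comparison vnL L1 trT primeL Lf Lq pf pq.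
  exists [:: v]; split=> //.
  - move=> u; rewrite inE => /eqP->; split=> // v0.
    by apply: q0; rewrite -vvq v0 mulr0.
  - by rewrite big_seq1.
  - by rewrite mul1r lerDr.
  - by left; rewrite -vvq trace_initial//; exact: trace_final_le.
have pvv := partial_isometry_proj pv.
have Lvv : L (adj v * v) by apply: vnaM => //; exact: vna_adj.
have [qq qa] := pq.
have qvv : q * (adj v * v) = adj v * v by rewrite mulrA -{1}qa -adjM vq.
have vvq : adj v * v * q = adj v * v by rewrite -mulrA vq.
have pq' := projectionB pq pvv qvv.
have Lq' : L (q - adj v * v) by exact: vnaB.
have Tq' : T (q - adj v * v) = T q - T f.
  by rewrite (traceB vnL trT)// trace_initial// vvf.
have [|us [usP us_orth us_sum us_size _]] := IH (q - adj v * v) _ Lq' pq'.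
  by rewrite Tq' ltrBlDr; move: qN; rewrite -natr1 mulrDl mul1r.
exists (v :: us); split=> //.
- move=> u; rewrite in_cons => /orP[/eqP->|/usP[Lu pu fu uq u0]].
    split=> // v0; move: f0; rewrite -vvf v0 mul0r.
    by rewrite (trace0 vnL L1 trT) ltxx.
  by split=> //; rewrite -uq -mulrA mulrBl qq vvq.
- rewrite /orthogonal_pieces pairwise_cons; apply/andP; split=> //.
  apply/allP => u /usP[Lu pu fu uq u0] /=; apply/eqP.
  rewrite -[in adj u]uq adjM; case: pq' => _ ->.
  by rewrite !mulrA mulrBr vvq pvv.1 subrr !mul0r.
- by rewrite big_cons us_sum addrC subrK.
- by rewrite /= -natr1 mulrDl mul1r; move: us_size; rewrite Tq'; lra.
- by right; exists v => //; rewrite mem_head.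
Qed.

End Subdivision.

Lemma pairwise_in (I : eqType) (r : rel I) (s : seq I) :
  {in s &, forall x y, r x y -> r y x} -> pairwise r s ->
  {in s &, forall x y, x != y -> r x y}.
Proof.
elim: s => // z s IH rsym; rewrite pairwise_cons => /andP[/allP zs ss] x y.
have {}IH := IH (sub_in2 (mem_behead (s := z :: s)) rsym) ss.
rewrite !in_cons => /orP[/eqP->|xs] /orP[/eqP->|ys]; rewrite ?eqxx//.
- by move=> _; exact: zs.
- by move=> _; apply: rsym; rewrite ?mem_head ?in_cons ?xs ?orbT ?zs.
- exact: IH.
Qed.

Lemma pairwise_uniq (I : eqType) (r : rel I) (s : seq I) : pairwise r s ->
  (forall x, x \in s -> ~~ r x x) -> uniq s.
Proof.
elim: s => //= z s IH /andP[/allP zs ss] irr; rewrite IH ?andbT//.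
  by apply/negP => /zs; apply/negP; apply: irr; rewrite mem_head.
by move=> x xs; apply: irr; rewrite in_cons xs orbT.
Qed.

Lemma sum_op_fun (R : realType) (H : hilbertSpace R) (I : Type) (r : seq I) (F : I -> op H) :
  \sum_(i <- r) op_fun (F i) = op_fun (\sum_(i <- r) F i).
Proof.
by rewrite (big_morph (@op_fun R H) (id1 := 0) (op1 := +%R))// => a b; apply/funext => x; rewrite opDE.
Qed.

(** * The inequality between two corners *)

Section AmplificationInequality.
Variables (R : realType) (H : hilbertSpace R) (L : set (H -> H)) (tr : (H -> H) -> R[i]).
Let T (a : op H) : R := complex.Re (tr a).
Hypotheses (vnL : von_neumann_algebra L) (L1 : L idfun) (trT : finite_trace L T).
Hypothesis primeL : prime_vna L.
Hypothesis smallL : forall x : R, 0 < x ->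
  exists q : op H, [/\ L q, projection q, q <> 0 & T q < x].
Implicit Types (a b d e f r u v w : op H) (g : H -> H).

(** The invariant speaks of finite sets of bare functions; this total coercion, with default value
    0, brings their members into the *-ring. *)
Definition toop (g : H -> H) : op H :=
  if pselect (adjointable g) is left gP then mkop gP else 0.

Lemma toopK a : toop a = a.
Proof. by rewrite /toop; case: pselect => [h|[]]; [exact: op_eq|exact: opP]. Qed.

Lemma toop_fun g : L g -> op_fun (toop g) = g.
Proof. by move=> /(vna_op vnL)[a <-]; rewrite toopK. Qed.

Lemma Re_div_real (z : R[i]) (s : R) : complex.Re (z / s%:C) = complex.Re z / s.
Proof.
have -> : (s%:C)^-1 = (s^-1)%:C :> R[i] by rewrite fmorphV.
by case: z => x y /=; rewrite mulr0 subr0.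
Qed.

(** Several pieces may give the same operator, and a finite set keeps a single copy; the cost summed
    over the list is still an upper bound. *)
Lemma le_sum_undup (I : eqType) (s : seq I) (F : I -> R) : (forall i, 0 <= F i) ->
  \sum_(i <- undup s) F i <= \sum_(i <- s) F i.
Proof.
move=> F0; elim: s => //= i s IH; rewrite big_cons.
by case: ifP => _; [apply: ler_wpDl|rewrite big_cons lerD2l].
Qed.

(** Orthogonality leaves [r], [d] as the only pair of the partition that can contribute to
    [y = r * y * d]. *)
Lemma calI_elt_le (tau : (H -> H) -> R[i]) (P : {fset (H -> H)}) (A : set (H -> H)) g
    (y r d : op H) :
  projection_partition A g P -> (forall p : H -> H, p \in P -> 0 <= complex.Re (tau p)) ->
  op_fun r \in P -> op_fun d \in P -> r * y = y -> y * d = y ->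
  calI_elt tau y P <= complex.Re (tau r) * complex.Re (tau d).
Proof.
move=> [Pp Porth _] tau0 rP dP ry yd.
have h (p : H -> H) : p \in P -> p <> op_fun r -> p \o y = 0.
  by move=> pP pr; rewrite -ry; apply/funext => x /=; have /(congr1 (@^~ (y x))) := Porth _ _ pP rP pr.
have h' (q : H -> H) : q \in P -> q <> op_fun d -> (y : H -> H) \o q = 0.
  move=> qP qd; rewrite -yd; apply/funext => x /=.
  have /(congr1 (@^~ x)) /= := Porth _ _ dP qP (nesym qd).
  by move=> ->; rewrite raddf0.
rewrite /calI_elt (bigD1_seq (op_fun r))//= ?fset_uniq//.
rewrite [X in _ + X]big1_seq ?addr0; last first.
  move=> p /andP[/eqP pr pP]; rewrite big1_seq// => q /andP[+ qP].
  move=> /eqP []; rewrite -[LHS]/((p \o y) \o q) h//.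
have le1 : \sum_(q <- P | op_fun r \o op_fun y \o q != 0) complex.Re (tau r) * complex.Re (tau q) <=
    \sum_(q <- P | q == op_fun d) complex.Re (tau r) * complex.Re (tau q).
  rewrite big_mkcond [leRHS]big_mkcond big_seq [leRHS]big_seq; apply: ler_sum => q qP.
  have [->|qd] := eqVneq q (op_fun d).
    by case: ifP => // _; rewrite mulr_ge0 ?tau0.
  case: ifP => // /eqP[]; rewrite -[LHS]/(r \o (y \o q)) h'//; last exact/eqP.
  by apply/funext => x; rewrite /= raddf0.
apply: (le_trans le1); rewrite big_mkcond (bigD1_seq (op_fun d))//= ?fset_uniq// eqxx.
by rewrite big1 ?addr0// => q /negbTE ->.
Qed.

Section GeneratorTransfer.
Variables e f : op H.
Hypotheses (Le : L e) (Lf : L f) (pe : projection e) (pf : projection f).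
Variables (Te Tf : R).
Hypotheses (tre : tr e = Te%:C) (trf : tr f = Tf%:C) (Te0 : 0 < Te) (Tf0 : 0 < Tf).

Let TeE : T e = Te. Proof. by rewrite /T tre. Qed.
Let TfE : T f = Tf. Proof. by rewrite /T trf. Qed.
Let taue (g : H -> H) := tr g / tr e.
Let tauf (g : H -> H) := tr g / tr f.

(** Compare [f] with a projection [q] of trace below both [d] and [T f]. The trace rules out that
    [f] is equivalent to a part of [q], so [q] is equivalent to a part [f1] of [f]. *)
Lemma small_subprojection (d : R) : 0 < d ->
  exists f1 : op H, [/\ L f1, projection f1, f * f1 = f1, 0 < T f1 & T f1 < d].
Proof.
move=> d0; have m0 : 0 < Num.min d Tf by rewrite lt_min d0.
have [q [Lq pq q0]] := smallL m0; rewrite lt_min => /andP[qd qf].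
have [v [Lv pv fv vq vE]] := comparison vnL L1 trT primeL Lf Lq pf pq.
have Lv' := vna_adj vnL Lv.
have Tv : T (v * adj v) = T (adj v * v) by rewrite (trace_initial vnL trT).
case: vE => [vvq|vvf]; last first.
  have := trace_initial_le vnL trT Lv Lq pv pq vq.
  by rewrite -Tv vvf TfE leNgt qf.
exists (v * adj v); split.
- exact: vnaM.
- by have := partial_isometry_proj (partial_isometry_adj pv); rewrite adjK.
- by rewrite mulrA fv.
- by rewrite Tv vvq; exact: (trace_gt0 trT).
- by rewrite Tv vvq.
Qed.

Variables (X P : {fset (H -> H)}).
Hypotheses (XP : [set` X] `<=` corner L e) (genX : generated_vna [set` X] = corner L e)
  (PP : projection_partition (corner L e) e P).

Let PL p : p \in P -> [/\ L p, op_fun (toop p) = p & projection (toop p)].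
Proof.
case: PP => Pp _ _ /Pp[cp pp]; have Lp := corner_sub vnL Le cp.
by split=> //; [exact: toop_fun|apply/projectionP; rewrite toop_fun].
Qed.

Let XL x : x \in X -> L x /\ op_fun (toop x) = x.
Proof.
by move=> xX; have Lx := corner_sub vnL Le (XP xX); split=> //; exact: toop_fun.
Qed.

Let sum_toop : \sum_(p <- P) toop p = e.
Proof.
case: PP => _ _ sumP; apply: op_eq => x; rewrite -sumP.
have -> : (\sum_(p <- P) p) x = \sum_(p <- P) p x by rewrite fct_sumE.
have -> : (\sum_(p <- P) toop p) x = \sum_(p <- P) toop p x.
  by elim/big_rec2: _ => // i y1 y2 _ <-; rewrite opDE.
by apply: eq_big_seq => p /PL[_ -> _].
Qed.

(** The cost of [X] measured by [T]; each term holds two traces, so normalising takes out the square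
    of [Te]. *)
Let weight : R := \sum_(x <- X) \sum_(p <- P) \sum_(q <- P | p \o x \o q != 0) T (toop p) * T (toop q).

Let weightE : weight = Te ^+ 2 * calI_part taue X P.
Proof.
rewrite /weight /calI_part mulr_sumr; apply: eq_bigr => x _.
rewrite /calI_elt mulr_sumr; apply: eq_big_seq => p /PL[_ pE _].
rewrite mulr_sumr big_seq_cond [RHS]big_seq_cond; apply: eq_bigr => q /andP[/PL[_ qE _] _].
rewrite /taue tre !Re_div_real /T pE qE.
by field; rewrite gt_eqF.
Qed.

Lemma generator_transfer (eta : R) : 0 < eta ->
  (calG (corner L f) f (fun g => (tr g / tr f)%R)
    <= ((Te ^+ 2 * calI_part (fun g => (tr g / tr e)%R) X P + eta) / Tf ^+ 2)%:E)%E.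
Proof.
move=> eta0; rewrite -[calG _ _ _]/(calG _ _ tauf) -[calI_part _ X P]/(calI_part taue X P) -weightE.
have [p0 p0P p0_neq0] : exists2 p, p \in P & toop p <> 0.
  apply: contrapT => h; suff e0 : e = 0 by move: Te0; rewrite -TeE e0 (trace0 vnL L1 trT) ltxx.
  rewrite -sum_toop big1_seq// => p /andP[_ pP]; apply: contrapT => p0.
  by apply: h; exists p.
have T_ge0 p : p \in P -> 0 <= T (toop p).
  by move=> /PL[Lp pE pp]; apply: (finite_trace_ge0 trT) => //; rewrite pE.
have Tp0 : 0 < T (toop p0).
  by have [Lp pE pp] := PL p0P; apply: (trace_gt0 trT) => //; rewrite pE.
(* For [d <= 1], [(T p + d) (T q + d) <= T p * T q + d * (T p + T q + 1)], and the summand [Tf]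
   accounts for the elements [w]; thus [d * K] bounds the rounding error. *)
pose K : R := \sum_(x <- X) \sum_(p <- P) \sum_(q <- P | p \o x \o q != 0)
  (T (toop p) + T (toop q) + 1) + Tf.
have K0 : 0 <= K.
  apply: addr_ge0; last exact: ltW.
  apply: sumr_ge0 => x _; rewrite big_seq; apply: sumr_ge0 => p pP.
  rewrite big_seq_cond; apply: sumr_ge0 => q /andP[qP _].
  by rewrite !addr_ge0 ?T_ge0.
(* The bound [1] serves for [d^2 <= d], [T (toop p0)] ensures that the subdivision of [p0] has a
   piece with range [f1], and [eta / (K + 1)] gives [d * K <= eta]. *)
have D0 : 0 < Num.min 1 (Num.min (T (toop p0)) (eta / (K + 1))).
  by rewrite !lt_min ltr01 Tp0/= divr_gt0// ltr_wpDl.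
have [f1 [Lf1 pf1 ff1 d0]] := small_subprojection D0.
rewrite !lt_min => /and3P[d1 dp0 deta]; set d := T f1 in d0 d1 dp0 deta.
have [[f11 f1a] [_ fa]] := (pf1, pf).
have f1f : f1 * f = f1 by rewrite -f1a -fa -adjM ff1.
have /choice[us usP] : forall p, exists us : seq (op H), p \in P ->
    [/\ forall u, u \in us -> [/\ L u, f1 * u = u & u * toop p = u],
        \sum_(u <- us) adj u * u = toop p,
        (size us)%:R * d <= T (toop p) + d &
        T (toop p) <= d \/ exists2 u, u \in us & u * adj u = f1].
  move=> p; have [pP|] := boolP (p \in P); last by exists [::].
  have [Lp pE pp] := PL pP; rewrite -pE in Lp.
  have [us [usP _ us_sum us_size us_full]] := subdivide vnL L1 trT primeL Lf1 pf1 d0 Lp pp.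
  by exists us => _; split=> // u /usP[].
have [ws [wsP ws_orth ws_sum ws_size _]] :=
  subdivide vnL L1 trT primeL Lf1 pf1 d0 (vnaB vnL Lf Lf1) (projectionB pf pf1 ff1).
pose qs := f1 :: [seq adj w * w | w <- ws].
have qsP (q : op H) : q \in qs -> [/\ L q, projection q, q * f = q, q <> 0 & T q <= d].
  rewrite in_cons => /orP[/eqP->|/mapP[w /wsP[Lw pw fw wf w0] ->]].
    split=> // f10; move: d0; rewrite /d f10 (trace0 vnL L1 trT).
    by rewrite ltxx.
  split.
  - by apply: vnaM => //; exact: vna_adj.
  - exact: partial_isometry_proj.
  - by rewrite -mulrA -wf -mulrA mulrBl f1f (_ : f * f = f)//; case: pf.
  - by move/adj_mul_eq0.
  - by rewrite (trace_initial vnL trT)//; exact: (trace_final_le vnL trT).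
have qs_orth : pairwise [rel a b : op H | a * b == 0] qs.
  rewrite /qs pairwise_cons pairwise_map; apply/andP; split; last exact: ws_orth.
  apply/allP => _ /mapP[w /wsP[Lw pw fw wf w0] ->] /=; apply/eqP.
  have f1d : f1 * (f - f1) = 0 by rewrite mulrBr f1f f11 subrr.
  by rewrite -[in adj w]wf adjM adjB f1a fa !mulrA f1d !mul0r.
have qs_uniq : uniq qs.
  apply: pairwise_uniq qs_orth _ => q /qsP[_ [qq _] _ q0 _] /=.
  by apply/eqP; rewrite qq.
have qs_orth2 (q r : op H) : q \in qs -> r \in qs -> q != r -> q * r = 0.
  move=> qqs rqs qr; apply/eqP.
  apply: (@pairwise_in _ [rel a b : op H | a * b == 0] qs) => // a b aqs bqs /= /eqP ab.
  have [[_ [_ aa] _ _ _] [_ [_ ba] _ _ _]] := (qsP _ aqs, qsP _ bqs).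
  by rewrite -aa -ba -adjM ab adj0.
pose Q : {fset (H -> H)} := seq_fset tt [seq op_fun q | q <- qs].
have QE g : g \in Q -> exists2 q : op H, q \in qs & g = q.
  by rewrite seq_fsetE => /mapP[q qqs ->]; exists q.
have inQ (q : op H) : q \in qs -> op_fun q \in Q by move=> qqs; rewrite seq_fsetE map_f.
have sumQ : \sum_(g <- Q) g = op_fun f.
  rewrite (perm_big _ (seq_fset_perm _ _)) undup_id; last first.
    rewrite (map_inj_uniq (f := @op_fun R H)); last by move=> a b /val_inj.
    exact: qs_uniq.
  rewrite big_map sum_op_fun big_cons big_map ws_sum.
  by rewrite addrC subrK.
have QP : projection_partition (corner L f) f Q.
  split=> //.
  - move=> g /QE[q /qsP[Lq pq qf _ _] ->]; split; last exact/projectionP.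
    apply/(cornerP vnL Lf pf); split=> //.
    by case: pq => _ qa; rewrite -[in LHS]qa -[in LHS]fa -adjM qf.
  - move=> g h /QE[q qqs ->] /QE[r rqs ->] qr.
    have := qs_orth2 q r qqs rqs; move=> /(_ _)/(congr1 (@op_fun R H)); apply.
    by apply/eqP => e'; apply: qr; rewrite e'.
pose us_all := \big[cat/[::]]_(p <- P) us p.
have us_allP u : u \in us_all -> exists2 p, p \in P & u \in us p.
  by move: u; apply: big_cat_ind => p pP _ u up; exists p.
pose Ys := (\big[cat/[::]]_(x <- X) \big[cat/[::]]_(p <- P)
  \big[cat/[::]]_(q <- P | p \o x \o q != 0)
    [seq u * toop x * adj v | u <- us p, v <- us q]) ++ ws.
(* Each generator lies in [f1 L r] for a single member [r] of the partition, [r = f1] for the blocks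
   and [r = adj w * w] for [w]; hence its cost is at most [(d / Tf) ^+ 2]. *)
have YsP (y : op H) : y \in Ys -> L y /\ exists r : op H, [/\ r \in qs, f1 * y = y & y * r = y].
  rewrite mem_cat => /orP[|/[dup] yws /wsP[Ly py fy yf _]]; last first.
    split=> //; exists (adj y * y); split=> //; last by rewrite mulrA.
    by rewrite in_cons (map_f (fun w => adj w * w) yws) orbT.
  move: y; apply: big_cat_ind => x /XL[Lx xE] _; apply: big_cat_ind => p pP _.
  apply: big_cat_ind => q qP _ _ /allpairsP[[u v] /= [up vq ->]].
  have [/(_ u up) [Lu fu _] _ _ _] := usP p pP.
  have [/(_ v vq) [Lv fv _] _ _ _] := usP q qP.
  split; first by do 2?apply: (vnaM vnL) => //; [rewrite xE|exact: vna_adj].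
  exists f1; split; first by rewrite mem_head.
    by rewrite !mulrA fu.
  by rewrite -!mulrA -[X in adj v * X]f1a -adjM fv.
pose Y : {fset (H -> H)} := seq_fset tt [seq op_fun y | y <- Ys].
have YE g : g \in Y -> exists2 y : op H, y \in Ys & g = y.
  by rewrite seq_fsetE => /mapP[y yYs ->]; exists y.
have inY (y : op H) : y \in Ys -> op_fun y \in Y by move=> yYs; rewrite seq_fsetE map_f.
have Y_corner : [set` Y] `<=` corner L f.
  move=> g /= /YE[y /YsP[Ly [r [rqs fy yr]]] ->].
  apply/(cornerP vnL Lf pf); split=> //; first by rewrite -fy mulrA ff1.
  by have [_ _ rf _ _] := qsP _ rqs; rewrite -yr -mulrA rf.
have genY : generated_vna [set` Y] = corner L f.
  apply/seteqP; split=> [g|]; first by apply=> //; exact: corner_vna.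
  move=> g cg B vnB YB; move: g cg.
  apply: (@corner_generation _ _ _ vnL e f f1 us_all ws [set` X]) => //.
  - move=> u /us_allP[p pP up]; have [/(_ u up)[Lu fu uq] _ _ _] := usP p pP.
    split=> //; case: PP => /(_ p pP)[cp _] _ _.
    have [Lp pE _] := PL pP; rewrite -pE in cp.
    by have [_ _ pe'] := (cornerP vnL Le pe _).1 cp; rewrite -uq -mulrA pe'.
  - rewrite /us_all (big_morph (fun s => \sum_(u <- s) adj u * u) (id1 := 0) (op1 := +%R)).
    + rewrite -[RHS]sum_toop; apply: eq_big_seq => p pP.
      by have [_ -> _ _] := usP p pP.
    + by move=> s s'; rewrite big_cat.
    + by rewrite big_nil.
  - have [_ _ _ [|[u up uf]]] := usP p0 p0P; first by rewrite leNgt dp0.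
    by exists u => //; exact: mem_big_cat up.
  - by move=> w /wsP[].
  - by rewrite ws_sum addrC subrK.
  - move=> a u v Xa /us_allP[p pP up] /us_allP[q qP vq].
    have [/(_ u up) [Lu fu uE] _ _ _] := usP p pP.
    have [/(_ v vq) [Lv fv vE] _ _ _] := usP q qP.
    have [[Lp pE pp] [Lq qE [_ qa]]] := (PL pP, PL qP).
    (* If [p a q = 0] the block [u * a * adj v] is 0, so leaving such triples out of [Ys] loses
       nothing, and the length of [Ys] matches the restricted sum in [weight]. *)
    have [paq|paq] := eqVneq (p \o op_fun a \o q) 0.
      have paq0 : toop p * a * toop q = 0.
        by apply: op_eq => x; rewrite !opME pE qE; exact: (congr1 (@^~ x) paq).
      have -> : u * a * adj v = u * (toop p * a * toop q) * adj v.
        by rewrite -{1}uE -{1}vE adjM qa !mulrA.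
      by rewrite paq0 mulr0 mul0r; exact: vna0.
    apply: YB; apply: inY; rewrite mem_cat; apply/orP; left.
    apply: (mem_big_cat Xa) => //; apply: (mem_big_cat pP) => //; apply: (mem_big_cat qP) => //.
    by apply/allpairsP; exists (u, v) => /=; split=> //; rewrite toopK.
  - by move=> w wws; apply: YB; apply: inY; rewrite mem_cat wws orbT.
have Re_tauf (q : op H) : complex.Re (tauf q) = T q / Tf by rewrite /tauf trf Re_div_real.
have tauf_ge0 g : g \in Q -> 0 <= complex.Re (tauf g).
  move=> /QE[q /qsP[Lq pq _ _ _] ->]; rewrite Re_tauf divr_ge0 ?(ltW Tf0)//.
  exact: (finite_trace_ge0 trT).
have calI_elt_ge0 g : 0 <= calI_elt tauf g Q.
  rewrite /calI_elt big_seq; apply: sumr_ge0 => p pQ.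
  by rewrite big_seq_cond; apply: sumr_ge0 => q /andP[qQ _]; rewrite mulr_ge0 ?tauf_ge0.
have cost (y : op H) : y \in Ys -> calI_elt tauf y Q <= (d / Tf) ^+ 2.
  move=> /YsP[Ly [r [rqs fy yr]]].
  apply: (le_trans (calI_elt_le QP tauf_ge0 (inQ f1 (mem_head _ _)) (inQ r rqs) fy yr)).
  rewrite !Re_tauf expr2 -/d ler_wpM2l ?divr_ge0 ?(ltW d0) ?(ltW Tf0)//.
  by rewrite ler_wpM2r ?invr_ge0 ?(ltW Tf0)//; case: (qsP _ rqs).
have calI_le : calI_part tauf Y Q <= (size Ys)%:R * (d / Tf) ^+ 2.
  rewrite /calI_part (perm_big _ (seq_fset_perm _ _)).
  apply: (le_trans (le_sum_undup _ calI_elt_ge0)).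
  rewrite big_map; apply: (@le_trans _ _ (\sum_(y <- Ys) (d / Tf) ^+ 2)).
    by rewrite big_seq [leRHS]big_seq; apply: ler_sum => y; exact: cost.
  by rewrite big_const_seq count_predT iter_addr_0 mulr_natl.
(* A triple contributes [size (us p) * size (us q)] elements, with [size (us p) * d <= T p + d]; for
   [ws] the corresponding bound is [T (f - f1) + d = T f]. *)
have size_le : (size Ys)%:R * d ^+ 2 <= weight + d * K.
  rewrite /Ys size_cat size_big_cat natrD natr_sum mulrDl /weight /K mulrDr addrA.
  apply: lerD; last first.
    rewrite expr2 mulrA mulrC ler_wpM2l ?(ltW d0)//.
    by move: ws_size; rewrite -/d (traceB vnL trT)// TfE subrK.
  rewrite mulr_suml mulr_sumr -big_split/=; apply: ler_sum => x _.
  rewrite size_big_cat natr_sum mulr_suml mulr_sumr -big_split/=.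
  rewrite big_seq [leRHS]big_seq; apply: ler_sum => p pP.
  rewrite size_big_cat natr_sum mulr_suml mulr_sumr -big_split/=.
  rewrite big_seq_cond [leRHS]big_seq_cond; apply: ler_sum => q /andP[qP _].
  have [_ _ hp _] := usP p pP; have [_ _ hq _] := usP q qP.
  rewrite size_allpairs natrM expr2 mulrACA.
  apply: (le_trans (ler_pM _ _ hp hq)); rewrite ?mulr_ge0 ?(ltW d0)//.
  have dd : d * d <= d by rewrite ger_pMl// ltW.
  by move: dd; set x' := T _; set y' := T _; nra.
apply: (@le_trans _ _ (calI (corner L f) f tauf Y)).
  by apply: ereal_inf_lbound; exists Y.
apply: (@le_trans _ _ (calI_part tauf Y Q)%:E).
  by apply: ereal_inf_lbound; exists Q.
rewrite lee_fin; apply: (le_trans calI_le).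
rewrite expr_div_n mulrA ler_wpM2r ?invr_ge0 ?exprn_ge0 ?(ltW Tf0)//.
apply: (le_trans size_le); rewrite lerD2l.
move: deta; rewrite ltr_pdivlMr ?ltr_wpDl// => h; apply: le_trans (ltW h).
by rewrite ler_wpM2l ?(ltW d0)// lerDl.
Qed.

End GeneratorTransfer.

(** Dividing by the positive constant isolates the infimum, which is then bounded below one [X] and
    one [P] at a time; this includes the empty infimum [+oo]. Taking [eta = x * Tf ^+ 2] leaves an
    error [x] after normalisation. *)
Lemma corner_calG_le (e f : op H) (Te Tf : R) :
  L e -> L f -> projection e -> projection f ->
  tr e = Te%:C -> tr f = Tf%:C -> 0 < Te -> 0 < Tf ->
  (calG (corner L f) f (fun g => (tr g / tr f)%R)
    <= ((Te / Tf) ^+ 2)%:E * calG (corner L e) e (fun g => (tr g / tr e)%R))%E.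
Proof.
move=> Le Lf pe pf tre trf Te0 Tf0.
rewrite -lee_pdivrMl ?exprn_gt0 ?divr_gt0//.
apply/ereal_infP => _ [X [XP genX] <-]; apply/ereal_infP => _ [P PP <-].
rewrite lee_pdivrMl ?exprn_gt0 ?divr_gt0//.
apply/lee_addgt0Pr => x x0.
have x0' : 0 < x * Tf ^+ 2 by rewrite mulr_gt0 ?exprn_gt0.
apply: (le_trans (generator_transfer Le Lf pe pf tre trf Te0 Tf0 XP genX PP x0')).
by rewrite -EFinM -EFinD lee_fin mulrDl mulfK ?gt_eqF ?exprn_gt0// expr_div_n mulrAC.
Qed.

End AmplificationInequality.

(** * Matrix amplifications *)

Section MatrixOperators.
Variables (R : realType) (H : hilbertSpace R) (n : nat).
Local Notation K := (hilbert_power H n).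
Implicit Types (a b : op K) (i j k : 'I_n).

Definition coord (x : K) i : H := (x : {ffun 'I_n -> H}) i.
Definition inject i (y : H) : K := [ffun k => if k == i then y else 0] : {ffun 'I_n -> H}.

Lemma coord_eq (x y : K) : (forall i, coord x i = coord y i) -> x = y.
Proof. by move=> xy; apply/ffunP. Qed.

Lemma coordP (s : R[i]) (x y : K) i : coord (s *: x + y) i = s *: coord x i + coord y i.
Proof. by rewrite /coord !ffunE. Qed.

Lemma coord_inject i k y : coord (inject i y) k = if k == i then y else 0.
Proof. by rewrite /coord ffunE. Qed.

Lemma hdot_power (x y : K) : hdot x y = \sum_(i < n) hdot (coord x i) (coord y i).
Proof. by []. Qed.

Lemma hdot_inject_r i (x : K) y : hdot x (inject i y) = hdot (coord x i) y.
Proof.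
rewrite hdot_power (bigD1 i)//= coord_inject eqxx big1 ?addr0// => k /negbTE ki.
by rewrite coord_inject ki hdot0r.
Qed.

Lemma hdot_inject_l i y (x : K) : hdot (inject i y) x = hdot y (coord x i).
Proof. by rewrite hdotC hdot_inject_r -hdotC. Qed.

Lemma hnorm_inject i y : hnorm (inject i y) = hnorm y.
Proof. by rewrite /hnorm /dot_norm hdot_inject_r coord_inject eqxx. Qed.

Lemma hnorm_coord (x : K) i : hnorm (coord x i) <= hnorm x.
Proof.
rewrite /hnorm /dot_norm ler_wsqrtr// -lecR hdot_power (bigD1 i)//= raddfD/= rmorphD lerDl.
rewrite ler0c raddf_sum; apply: sumr_ge0 => k _ /=.
by have := hdot_ge0 (coord x k); rewrite lecE => /andP[].
Qed.

Lemma injectP i (s : R[i]) y z : inject i (s *: y + z) = s *: inject i y + inject i z.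
Proof.
apply: coord_eq => k; rewrite coordP !coord_inject.
by case: ifP => // _; rewrite scaler0 addr0.
Qed.

Lemma sum_inject (x : K) : x = \sum_(i < n) inject i (coord x i).
Proof.
apply: coord_eq => k; rewrite [RHS](_ : _ = \sum_(i < n) coord (inject i (coord x i)) k).
  rewrite (bigD1 k)//= coord_inject eqxx big1 ?addr0// => i ik.
  by rewrite coord_inject eq_sym (negbTE ik).
by rewrite /coord sum_ffunE.
Qed.

Lemma hnorm_le_sum (x : K) : hnorm x <= \sum_(i < n) hnorm (coord x i).
Proof.
rewrite {1}[x]sum_inject; apply: le_trans (ler_hnorm_sum _ _) _.
by apply: ler_sum => i _; rewrite hnorm_inject.
Qed.

Lemma matrix_entryE (f : K -> K) i j y : matrix_entry f i j y = coord (f (inject j y)) i.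
Proof. by []. Qed.

Lemma bounded_entry (f : K -> K) i j : bounded_operator f -> bounded_operator (matrix_entry f i j).
Proof.
move=> [lf [c cf]]; split.
  by move=> s y z; rewrite !matrix_entryE injectP lf coordP.
exists c => y; rewrite matrix_entryE; apply: le_trans (hnorm_coord _ _) _.
by apply: le_trans (cf _) _; rewrite hnorm_inject.
Qed.

Lemma adjointable_entry a i j : adjointable (matrix_entry a i j).
Proof.
split; first by apply: bounded_entry; case: (opP a).
exists (matrix_entry (adj a) j i); first by apply: bounded_entry; case: (opP (adj a)).
by move=> x y; rewrite !matrix_entryE -hdot_inject_r adjP hdot_inject_l.
Qed.

Definition ent a i j : op H := mkop (adjointable_entry a i j).

Lemma entE a i j y : ent a i j y = coord (a (inject j y)) i.
Proof. by []. Qed.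

Lemma coord_op a x i : coord (a x) i = \sum_(j < n) ent a i j (coord x j).
Proof.
rewrite {1}[x]sum_inject raddf_sum /coord sum_ffunE.
by apply: eq_bigr => j _; rewrite entE.
Qed.

Lemma ent_eq a b : (forall i j, ent a i j = ent b i j) -> a = b.
Proof.
move=> ab; apply: op_eq => x; apply: coord_eq => i; rewrite !coord_op.
by apply: eq_bigr => j _; rewrite ab.
Qed.

Lemma adj_ent a i j : adj (ent a i j) = ent (adj a) j i.
Proof.
by apply: adj_eq => x y; rewrite !entE -hdot_inject_r adjP hdot_inject_l.
Qed.

Lemma ent0 i j : ent 0 i j = 0.
Proof. by apply: op_eq => y; rewrite entE !opE /coord ffunE. Qed.

Lemma entP (s : R[i]) a b i j : ent (s *: a + b) i j = s *: ent a i j + ent b i j.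
Proof. by apply: op_eq => y; rewrite !opE !entE !opE coordP. Qed.

Lemma entD a b i j : ent (a + b) i j = ent a i j + ent b i j.
Proof. by have := entP 1 a b i j; rewrite !scale1r. Qed.

Lemma op_sumE (L : hilbertSpace R) (I : Type) (r : seq I) (F : I -> op L) y :
  (\sum_(i <- r) F i) y = \sum_(i <- r) F i y.
Proof. by elim/big_rec2: _ => // i y1 y2 _ <-; rewrite opDE. Qed.

Lemma entM a b i j : ent (a * b) i j = \sum_(k < n) ent a i k * ent b k j.
Proof. by apply: op_eq => y; rewrite op_sumE entE opME coord_op. Qed.

Lemma mxop_bounded (A : 'I_n -> 'I_n -> op H) :
  bounded_operator (matrix_operator (\matrix_(i, j) op_fun (A i j)) : K -> K).
Proof.
have matE x i : coord (matrix_operator (\matrix_(i, j) op_fun (A i j)) x : K) i =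
    \sum_(j < n) A i j (coord x j).
  by rewrite /coord ffunE; apply: eq_bigr => j _; rewrite mxE.
split=> [s x y|].
  apply: coord_eq => i; rewrite coordP !matE scaler_sumr -big_split.
  by apply: eq_bigr => j _; rewrite coordP linearP.
have /choice[c cP] : forall ij : 'I_n * 'I_n, exists c : R, 0 <= c /\
    forall x, hnorm (A ij.1 ij.2 x) <= c * hnorm x.
  by move=> [i j]; have [c c0 cA] := op_bound (A i j); exists c.
exists (\sum_(i < n) \sum_(j < n) c (i, j)) => x.
apply: le_trans (hnorm_le_sum _) _; rewrite mulr_suml; apply: ler_sum => i _.
rewrite matE; apply: le_trans (ler_hnorm_sum _ _) _; rewrite mulr_suml; apply: ler_sum => j _.
have [c0 cA] := cP (i, j); apply: le_trans (cA _) _.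
by rewrite ler_wpM2l// hnorm_coord.
Qed.

Lemma mxop_adjointable (A : 'I_n -> 'I_n -> op H) :
  adjointable (matrix_operator (\matrix_(i, j) op_fun (A i j)) : K -> K).
Proof.
split; first exact: mxop_bounded.
exists (matrix_operator (\matrix_(i, j) op_fun (adj (A j i)))).
  exact: (mxop_bounded (fun i j => adj (A j i))).
move=> x y; rewrite !hdot_power.
transitivity (\sum_(i < n) \sum_(j < n) hdot (A i j (coord x j)) (coord y i)).
  apply: eq_bigr => i _; rewrite /coord ffunE.
  rewrite (big_morph (fun z => hdot z (coord y i)) (id1 := 0) (op1 := +%R)).
  - by apply: eq_bigr => j _; rewrite mxE.
  - by move=> u v; rewrite hdotDl.
  - exact: hdot0l.
rewrite exchange_big; apply: eq_bigr => j _ /=; rewrite [in RHS]/coord ffunE.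
rewrite (big_morph (hdot (coord x j)) (id1 := 0) (op1 := +%R)).
- by apply: eq_bigr => i _; rewrite mxE adjP.
- by move=> u v; rewrite hdotDr.
- exact: hdot0r.
Qed.

Definition mxop (A : 'I_n -> 'I_n -> op H) : op K := mkop (mxop_adjointable A).

Lemma ent_mxop A i j : ent (mxop A) i j = A i j.
Proof.
apply: op_eq => y; rewrite entE /coord ffunE (bigD1 j)//= mxE ffunE eqxx.
rewrite big1 ?addr0// => k /negbTE kj.
by rewrite mxE ffunE kj raddf0.
Qed.

Definition unit_mx j k (x : op H) : op K :=
  mxop (fun i l => if (i == j) && (l == k) then x else 0).

Lemma ent_unit_mx j k x i l : ent (unit_mx j k x) i l = if (i == j) && (l == k) then x else 0.
Proof. exact: ent_mxop. Qed.

Lemma ent_mul_unit_mx a b j k x i l :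
  ent (a * unit_mx j k x * b) i l = ent a i j * x * ent b k l.
Proof.
rewrite entM (bigD1 k)//= entM (bigD1 j)//= ent_unit_mx !eqxx big1 ?addr0; last first.
  by move=> r /negbTE rj; rewrite ent_unit_mx rj mulr0.
rewrite big1 ?addr0// => s /negbTE sk; rewrite entM big1 ?mul0r// => r _.
by rewrite ent_unit_mx sk andbF mulr0.
Qed.

Section Algebra.
Variable M : set (H -> H).
Hypothesis vnM : von_neumann_algebra M.

Lemma matrix_algebra_op a : matrix_algebra M a <-> forall i j, M (ent a i j).
Proof.
split=> [[A MA Aa] i j|Ma].
  have -> : op_fun (ent a i j) = A i j; last exact: MA.
  apply/funext => y; rewrite entE -Aa /coord ffunE (bigD1 j)//= ffunE eqxx.
  rewrite big1 ?addr0// => k /negbTE kj; rewrite ffunE kj.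
  by have [b <-] := vna_op vnM (MA i k); rewrite raddf0.
exists (\matrix_(i, j) op_fun (ent a i j)) => [i j|]; first by rewrite mxE.
apply/funext => x; apply: coord_eq => i; rewrite coord_op /coord ffunE.
by apply: eq_bigr => j _; rewrite mxE.
Qed.

Lemma matrix_algebra_ex f : matrix_algebra M f -> exists a, op_fun a = f.
Proof.
move=> [A MA <-]; have /choice[B BA] : forall ij : 'I_n * 'I_n, exists b : op H, op_fun b = A ij.1 ij.2.
  by move=> [i j]; exact: (vna_op vnM (MA i j)).
exists (mxop (fun i j => B (i, j))); congr matrix_operator.
by apply/matrixP => i j; rewrite mxE BA.
Qed.

Lemma matrix_algebra_vna : von_neumann_algebra (matrix_algebra M : set (K -> K)).
Proof.
split.
- by move=> f /matrix_algebra_ex[a <-]; case: (opP a).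
- by apply/(matrix_algebra_op 0) => i j; rewrite ent0; exact: vna0.
- move=> s f g Mf Mg.
  have [a af] := matrix_algebra_ex Mf; have [b bg] := matrix_algebra_ex Mg.
  rewrite -af -bg in Mf Mg *.
  have -> : s *: op_fun a + op_fun b = op_fun (s *: a + b).
    by apply/funext => x; rewrite opDE opZE.
  apply/matrix_algebra_op => i j; rewrite entP.
  by apply: vnaD => //; [apply: vnaZ => //; exact: (matrix_algebra_op a).1|exact: (matrix_algebra_op b).1].
- move=> f g Mf Mg.
  have [a af] := matrix_algebra_ex Mf; have [b bg] := matrix_algebra_ex Mg.
  rewrite -af -bg in Mf Mg *; apply/(matrix_algebra_op (a * b)) => i j; rewrite entM.
  by apply: vna_sum => // k; apply: vnaM => //; [exact: (matrix_algebra_op a).1|exact: (matrix_algebra_op b).1].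
- move=> f Mf; have [a af] := matrix_algebra_ex Mf; rewrite -af in Mf *.
  exists (adj a); last by move=> x y; rewrite adjP.
  apply/matrix_algebra_op => i j; rewrite -adj_ent.
  by apply: vna_adj => //; exact: (matrix_algebra_op a).1.
- move=> f [bf cf].
  have Mf i j : M (matrix_entry f i j).
    apply: (vna_closed vnM); split=> [|s e e0]; first exact: bounded_entry.
    (* Testing an entry of [f] amounts to testing [f] at vectors supported on one coordinate. *)
    have [g Mg gs] := cf [seq (inject j z.1, inject i z.2) | z <- s] e e0.
    have [b bg] := matrix_algebra_ex Mg; rewrite -bg in Mg gs.
    exists (ent b i j); first exact: (matrix_algebra_op b).1.
    move=> x y xy; have := gs _ _ (map_f (fun z => (inject j z.1, inject i z.2)) xy).
    by congr (`|_| < _); rewrite /= !hdotBl !hdot_inject_r.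
  exists (\matrix_(i, j) matrix_entry f i j) => [i j|]; first by rewrite mxE.
  apply/funext => x; apply: coord_eq => i; rewrite [in RHS](sum_inject x).
  have -> : f (\sum_(j < n) inject j (coord x j)) = \sum_(j < n) f (inject j (coord x j)).
    apply: (big_morph f) => [u v|]; case: bf => lf _.
      by have := lf 1 u v; rewrite !scale1r.
    by have := lf (-1) 0 0; rewrite scaler0 addr0 scaleN1r addNr.
  rewrite /coord sum_ffunE ffunE; apply: eq_bigr => j _.
  by rewrite mxE.
Qed.

(** The entry at [i], [l] of [a * unit_mx j k x * b] is [ent a i j * x * ent b k l], so one nonzero
    entry of [a] forces every entry of [b] to vanish. *)
Lemma matrix_algebra_prime : prime_vna M -> prime_vna (matrix_algebra M : set (K -> K)).
Proof.
move=> pM a b /matrix_algebra_op Ma /matrix_algebra_op Mb ab.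
have [a0|] := pselect (forall i j, ent a i j = 0).
  by left; apply: ent_eq => i j; rewrite a0 ent0.
move=> /existsNP[i /existsNP[j aij]]; right; apply: ent_eq => k l; rewrite ent0.
have [x Mx||//] := pM _ _ (Ma i j) (Mb k l); last by move/aij.
rewrite -ent_mul_unit_mx ab ?ent0//.
apply/matrix_algebra_op => r s; rewrite ent_unit_mx; case: ifP => // _; exact: vna0.
Qed.

Lemma matrix_algebra_one : M idfun -> matrix_algebra M (@idfun K).
Proof.
move=> M1; apply/(matrix_algebra_op 1) => i j.
have -> : ent 1 i j = if i == j then 1 else 0.
  by apply: op_eq => y; rewrite entE op1E coord_inject; case: ifP.
by case: ifP => _; [exact: M1|exact: vna0].
Qed.

Lemma projection_unit_mx i q : projection q -> projection (unit_mx i i q).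
Proof.
move=> [qq qa]; split; apply: ent_eq => r s.
  rewrite entM ent_unit_mx (bigD1 i)//= !ent_unit_mx !eqxx/= andbT big1 ?addr0.
    by case: ifP => // _; case: ifP => // _; rewrite ?mul0r ?mulr0 ?qq.
  by move=> k /negbTE ki; rewrite !ent_unit_mx ki andbF mul0r.
by rewrite -adj_ent !ent_unit_mx andbC; case: ifP; rewrite ?adj0.
Qed.

End Algebra.
End MatrixOperators.

(** * Projections of small trace *)

Section SmallProjections.
Variables (R : realType) (H : hilbertSpace R) (L : set (H -> H)) (T : op H -> R).
Hypotheses (vnL : von_neumann_algebra L) (L1 : L idfun) (trT : finite_trace L T).

(** For [y] in the kernel of [q], [hnorm (p y) ^+ 2] is at most the quadratic form of [q] at [y],
    which is 0; so [p * (1 - q) = 0]. *)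
Lemma operator_le_projection (p q : op H) : projection p -> projection q ->
  operator_le p q -> q * p = p.
Proof.
move=> [pp pa] [qq qa] pq.
have e0 : p * (1 - q) = 0.
  apply: op_eq => x; apply/eqP; rewrite op0E opME -hnorm_eq0 -sqrf_eq0.
  set y := (1 - q) x; have := pq y.
  rewrite -[(op_fun q - op_fun p) y]/(q y - p y) hdotBl subr_ge0.
  have -> : q y = 0 by rewrite /y -opME mulrBr mulr1 qq subrr.
  have := adj_mul_hnorm p y; rewrite pa pp hdot0l => ->.
  by rewrite lecR => h; rewrite eq_le h sqr_ge0.
apply/eqP; rewrite eq_sym -subr_eq0; apply/eqP.
have -> : p - q * p = adj (p * (1 - q)) by rewrite adjM adjB adj1 pa qa mulrBl mul1r.
by rewrite e0 adj0.
Qed.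

(** A nonzero projection that is not minimal has a proper nonzero part, and either this part or its
    complement has at most half the trace; [N] such halvings reach [T 1 / 2 ^+ N]. *)
Lemma small_projections : (idfun : H -> H) <> 0 -> (forall p, ~ minimal_projection L p) ->
  forall x : R, 0 < x -> exists q : op H, [/\ L q, projection q, q <> 0 & T q < x].
Proof.
move=> id0 nomin.
have half N : exists q : op H, [/\ L q, projection q, q <> 0 & T q * 2 ^+ N <= T 1].
  elim: N => [|N [q [Lq pq q0 TqN]]].
    exists 1; rewrite expr0 mulr1; split=> //; first exact: projection1.
    by move=> /(congr1 (@op_fun R H)).
  have [p [Lp pp p0 pq' qp]] : exists p : op H, [/\ L p, projection p, p <> 0, p <> q & q * p = p].
    apply: contrapT => h; apply: (nomin q); split=> //; first exact/projectionP.
      by move=> e; apply: q0; apply: op_eq => x; rewrite e.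
    move=> p Lp pp pq'; have [a ap] := vna_op vnL Lp; rewrite -ap in Lp pp pq' *.
    have {}pp : projection a by exact/projectionP.
    have [->|/eqP a0] := eqVneq a 0; [by left|right].
    have [->//|/eqP aq] := eqVneq a q.
    by exfalso; apply: h; exists a; split=> //; exact: operator_le_projection.
  have Tqp := traceB vnL trT Lq Lp.
  have [le|lt] := lerP (T p * 2) (T q).
    exists p; split=> //; apply: le_trans TqN; rewrite exprS mulrA.
    by rewrite ler_wpM2r// exprn_ge0.
  exists (q - p); split; [exact: vnaB|exact: projectionB| |].
    by move=> /subr0_eq e; exact/pq'/esym.
  apply: le_trans TqN; rewrite exprS mulrA ler_wpM2r ?exprn_ge0// Tqp; lra.
move=> x x0; have [N hN] : exists N, T 1 / x < 2 ^+ N.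
  exists (Num.truncn (T 1 / x)).+1; apply: lt_le_trans (truncnS_gt _) _.
  by rewrite -natrX ler_nat ltnW// ltn_expl.
have [q [Lq pq q0 Tq]] := half N; exists q; split=> //.
have N0 : 0 < 2 ^+ N :> R by rewrite exprn_gt0.
rewrite -(ltr_pM2r N0); apply: le_lt_trans Tq _.
by rewrite mulrC -ltr_pdivrMr.
Qed.

End SmallProjections.

(** * The trace on matrices *)

Section MatrixTrace.
Variables (R : realType) (H : hilbertSpace R) (M : set (H -> H)) (tau : (H -> H) -> R[i]).
Hypotheses (vnM : von_neumann_algebra M) (M1 : M idfun) (trM : normal_trace M tau).

Lemma tauD (a b : op H) : M a -> M b -> tau (a + b) = tau a + tau b.
Proof.
move=> Ma Mb; have := trace_linear trM 1 Ma Mb; rewrite mul1r => <-.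
by congr tau.
Qed.

Lemma tau0 : tau (0 : op H) = 0.
Proof.
have := tauD (vna0 vnM) (vna0 vnM); rewrite addr0 => /eqP.
by rewrite -subr_eq subrr eq_sym => /eqP.
Qed.

Lemma tau_sum (I : Type) (r : seq I) (F : I -> op H) : (forall i, M (F i)) ->
  tau (\sum_(i <- r) F i : op H) = \sum_(i <- r) tau (F i).
Proof.
move=> MF; elim: r => [|i r IH]; first by rewrite !big_nil tau0.
by rewrite !big_cons tauD ?IH//; exact: vna_sum.
Qed.

Lemma tau_adj_mul_ge0 (a : op H) : M a -> 0 <= tau (adj a * a : op H).
Proof.
move=> Ma; apply: (trace_positive trM); last exact: opos_sqr.
by apply: (vnaM vnM) => //; exact: vna_adj.
Qed.

Lemma Re_eq0 (z : R[i]) : 0 <= z -> complex.Re z = 0 -> z = 0.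
Proof. by case: z => u v; rewrite lecE /= => /andP[/eqP -> _] ->. Qed.

Lemma normal_trace_finite : finite_trace M (fun a : op H => complex.Re (tau a)).
Proof.
split.
- by move=> a b Ma Mb; rewrite tauD// raddfD.
- by move=> a b Ma Mb; rewrite -(trace_tracial trM Mb Ma).
- move=> q Mq [qq qa]; have := tau_adj_mul_ge0 Mq; rewrite qa qq lecE.
  by move=> /andP[].
- move=> q Mq [qq qa] Tq; have := tau_adj_mul_ge0 Mq; rewrite qa qq => /Re_eq0/(_ Tq) tq.
  have := trace_faithful trM Mq _ tq => h; apply: op_eq => x.
  by rewrite h// -qq -[X in X * _]qa; exact: opos_sqr.
Qed.

Variable n : nat.
Hypothesis n0 : (0 < n)%N.
Local Notation K := (hilbert_power H n).
Local Notation T := (fun a : op K => complex.Re (matrix_trace tau a)).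

Lemma Re_natV_mul (z : R[i]) : complex.Re (n%:R^-1 * z) = n%:R^-1 * complex.Re z.
Proof.
have -> : (n%:R^-1 : R[i]) = (n%:R^-1)%:C by rewrite fmorphV rmorph_nat.
by case: z => x y /=; rewrite mul0r subr0.
Qed.

Lemma matrix_traceE (a : op K) : T a = n%:R^-1 * \sum_(i < n) complex.Re (tau (ent a i i)).
Proof. by rewrite /matrix_trace Re_natV_mul raddf_sum. Qed.

(** Positivity: [q = adj q * q] makes the diagonal entry at [i] the sum over [j] of
    [adj (ent q j i) * ent q j i]. Faithfulness: if the diagonal entries are 0, then [q] kills every
    vector [x] supported on one coordinate, since [hnorm (q x) ^+ 2] is the quadratic form of [q] at
    [x]. *)
Lemma matrix_trace_finite : finite_trace (matrix_algebra M) T.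
Proof.
have entM' (a : op K) : matrix_algebra M a -> forall i j, M (ent a i j).
  by move=> /(matrix_algebra_op vnM).
have n0' : (0 : R) < n%:R^-1 by rewrite invr_gt0 ltr0n.
have diag_ge0 (q : op K) : matrix_algebra M q -> projection q ->
    forall i, 0 <= complex.Re (tau (ent q i i)).
  move=> /entM' Mq [qq qa] i; rewrite -qq entM tau_sum => [|j]; last exact: vnaM.
  rewrite raddf_sum; apply: sumr_ge0 => j _; rewrite -{1}qa -adj_ent.
  by have := tau_adj_mul_ge0 (Mq j i); rewrite lecE => /andP[].
split.
- move=> a b /entM' Ma /entM' Mb; rewrite !matrix_traceE -mulrDr -big_split; congr (_ * _).
  by apply: eq_bigr => i _; rewrite entD tauD// raddfD.
- move=> a b /entM' Ma /entM' Mb; rewrite !matrix_traceE; congr (_ * _).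
  have tauM (c d : op K) : (forall i j, M (ent c i j)) -> (forall i j, M (ent d i j)) ->
    \sum_(i < n) complex.Re (tau (ent (c * d) i i)) =
    \sum_(i < n) \sum_(j < n) complex.Re (tau (ent c i j * ent d j i : op H)).
    move=> Mc Md; apply: eq_bigr => i _; rewrite entM tau_sum ?raddf_sum// => j.
    exact: vnaM.
  rewrite !tauM// exchange_big; apply: eq_bigr => i _; apply: eq_bigr => j _.
  by rewrite -(trace_tracial trM (Ma j i) (Mb i j)).
- by move=> q /diag_ge0 h pq; rewrite matrix_traceE mulr_ge0 ?(ltW n0')// sumr_ge0// => i _; exact: h.
- move=> q Lq pq; have Mq := entM' q Lq; have [qq qa] := pq; rewrite matrix_traceE => /eqP.
  rewrite mulf_eq0 gt_eqF// orFb psumr_eq0 => [/allP h|i _]; last exact: diag_ge0.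
  have qpos i : positive_operator (ent q i i).
    by move=> y; rewrite entE -hdot_inject_r -qq -[X in X * _]qa adj_mul_hnorm ler0c sqr_ge0.
  have qii i : ent q i i = 0.
    apply: op_eq => y; rewrite (trace_faithful trM (Mq i i) (qpos i))//.
    by apply: Re_eq0; [exact: (trace_positive trM)|apply/eqP/h; rewrite mem_index_enum].
  apply: op_eq => x; rewrite [x]sum_inject raddf_sum big1// => i _.
  apply/eqP; rewrite -hnorm_eq0 -sqrf_eq0; apply/eqP/complexI.
  by rewrite -adj_mul_hnorm qa qq hdot_inject_r -entE qii hdot0l.
Qed.

Variable i0 : 'I_n.

Lemma unit_mx_trace (x : op H) : matrix_trace tau (unit_mx i0 i0 x) = n%:R^-1 * tau x.
Proof.
rewrite /matrix_trace (bigD1 i0) // -[matrix_entry _ i0 i0]/(op_fun (ent _ i0 i0)) ent_unit_mx eqxx.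
rewrite big1 => [|i /negbTE ii0]; first by rewrite /= addr0.
by rewrite -[matrix_entry _ i i]/(op_fun (ent _ i i)) ent_unit_mx ii0 tau0.
Qed.

Lemma matrix_small_projections :
  (forall x : R, 0 < x -> exists q : op H, [/\ M q, projection q, q <> 0 & complex.Re (tau q) < x]) ->
  forall x : R, 0 < x -> exists q : op K, [/\ matrix_algebra M q, projection q, q <> 0 & T q < x].
Proof.
move=> smallM x /smallM[q [Mq pq q0 qx]]; exists (unit_mx i0 i0 q); split.
- by apply/(matrix_algebra_op vnM) => i j; rewrite ent_unit_mx; case: ifP => // _; exact: vna0.
- exact: projection_unit_mx.
- by move=> /(congr1 (fun a => ent a i0 i0)); rewrite ent_unit_mx !eqxx ent0.
- rewrite unit_mx_trace Re_natV_mul; apply: le_lt_trans qx.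
  rewrite ger_pMl ?invf_le1 ?ltr0n ?ler1n//.
  by apply: (trace_gt0 normal_trace_finite).
Qed.

End MatrixTrace.

(** * Invariance of the generator invariant *)

Section Transfer.
Variables (R : realType) (H1 H2 : hilbertSpace R).
Variables (A1 : set (H1 -> H1)) (A2 : set (H2 -> H2)) (e1 : H1 -> H1) (e2 : H2 -> H2).
Variables (tau1 : (H1 -> H1) -> R[i]) (tau2 : (H2 -> H2) -> R[i]).
Variable phi : (H1 -> H1) -> (H2 -> H2).
Hypotheses (vnA1 : von_neumann_algebra A1) (vnA2 : von_neumann_algebra A2).
Hypotheses (phi_in : forall f, A1 f -> A2 (phi f))
  (phi_surj : forall g, A2 g -> exists2 f, A1 f & phi f = g)
  (phi_inj : forall f g, A1 f -> A1 g -> phi f = phi g -> f = g)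
  (phi0 : phi 0 = 0) (phiD : forall f g, phi (f + g) = phi f + phi g)
  (phiM : forall f g, A1 f -> A1 g -> phi (f \o g) = phi f \o phi g)
  (phi_adj : forall f, A1 f -> is_adjoint f f -> is_adjoint (phi f) (phi f))
  (phi_unit : phi e1 = e2)
  (phi_tau : forall f, A1 f -> complex.Re (tau2 (phi f)) = complex.Re (tau1 f)).
(** Generation is defined by intersecting all von Neumann algebras on the ambient space. As [H1] and
    [H2] may differ, any [B] on [H2] needs a counterpart on [H1] that meets [A1] in the preimage of
    [B]. *)
Hypothesis phi_vna : forall B, von_neumann_algebra B ->
  exists2 B', von_neumann_algebra B' & forall f, A1 f -> (B' f <-> B (phi f)).

Lemma big_phi (X : {fset (H1 -> H1)}) (V : nmodType) (F : (H2 -> H2) -> V) :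
  [set` X] `<=` A1 ->
  \sum_(y <- seq_fset tt [seq phi x | x <- X]) F y = \sum_(x <- X) F (phi x).
Proof.
move=> XA; rewrite (perm_big _ (seq_fset_perm _ _)) undup_id ?big_map//.
rewrite map_inj_in_uniq ?fset_uniq// => x y /XA Ax /XA Ay.
exact: phi_inj.
Qed.

(** [phi] carries generating sets and partitions over, keeping traces and the vanishing of [p x q],
    so every cost available for [A1] is available for [A2]. *)
Lemma calG_transfer : (calG A2 e2 tau2 <= calG A1 e1 tau1)%E.
Proof.
apply/ereal_infP => _ [X [XA genX] <-]; apply/ereal_infP => _ [P [Pp Porth Psum] <-].
have PA : [set` P] `<=` A1 by move=> p /= /Pp[].
pose Y : {fset (H2 -> H2)} := seq_fset tt [seq phi x | x <- X].
pose Q : {fset (H2 -> H2)} := seq_fset tt [seq phi p | p <- P].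
have YP g : g \in Y -> exists2 x, x \in X & g = phi x by rewrite seq_fsetE => /mapP.
have QP g : g \in Q -> exists2 p, p \in P & g = phi p by rewrite seq_fsetE => /mapP.
have phi_eq0 f : A1 f -> (phi f == 0) = (f == 0).
  move=> Af; apply/eqP/eqP => [pf|->//].
  by apply: phi_inj => //; [exact: (vna_zero vnA1)|rewrite pf phi0].
apply: (@le_trans _ _ (calI A2 e2 tau2 Y)).
  apply: ereal_inf_lbound; exists Y => //; split.
    by move=> g /= /YP[x xX ->]; apply/phi_in/XA.
  apply/seteqP; split=> [g|g A2g B vnB YB].
    by apply=> // h /= /YP[x xX ->]; apply/phi_in/XA.
  have [f A1f <-] := phi_surj A2g.
  have [B' vnB' BB'] := phi_vna vnB.
  apply/BB' => //; move: A1f; rewrite -genX; apply=> // x xX.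
  by apply/BB'; [exact: XA|apply: YB; rewrite /= seq_fsetE map_f].
apply: ereal_inf_lbound; exists Q.
  split.
  - by move=> g /QP[p /Pp[Ap [pp pa]] ->]; split; [exact: phi_in|split; [rewrite -phiM// pp|exact: phi_adj]].
  - move=> g h /QP[p pP ->] /QP[q qP ->] pq; have [[Ap _] [Aq _]] := (Pp _ pP, Pp _ qP).
    by rewrite -phiM// Porth// => pq'; apply: pq; rewrite pq'.
  - by rewrite (big_phi id PA) -phi_unit -Psum (big_morph phi phiD phi0).
congr _%:E; rewrite /calI_part (big_phi (fun y => calI_elt tau2 y Q) XA).
apply: eq_big_seq => x xX; have Ax := XA _ xX; rewrite /calI_elt.
rewrite (big_phi (fun p => \sum_(q <- Q | p \o phi x \o q != 0) complex.Re (tau2 p) * complex.Re (tau2 q)) PA).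
apply: eq_big_seq => p pP; have Ap := PA _ pP.
rewrite big_mkcond (big_phi (fun q => if phi p \o phi x \o q != 0 then
   complex.Re (tau2 (phi p)) * complex.Re (tau2 q) else 0) PA) [RHS]big_mkcond.
apply: eq_big_seq => q qP; have Aq := PA _ qP.
have Apx : A1 (p \o x) by exact: (vna_mul vnA1).
rewrite -!phiM// phi_eq0 ?phi_tau//.
exact: (vna_mul vnA1).
Qed.

End Transfer.

(** * The algebra as a corner of its amplification *)

Section CornerOfMatrixAlgebra.
Variables (R : realType) (H : hilbertSpace R) (n : nat) (i0 : 'I_n).
Local Notation K := (hilbert_power H n).

(** The corner of the amplification at [i0] acts on [K], while [M] acts on [H]; [ampl] and
    [compress] move between the two. *)
Definition ampl (f : H -> H) (x : K) : K := inject i0 (f (coord x i0)).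
Definition compress (g : K -> K) : H -> H := matrix_entry g i0 i0.

Lemma amplK f : compress (ampl f) = f.
Proof.
by apply/funext => y; rewrite /compress matrix_entryE /ampl !coord_inject eqxx.
Qed.

Lemma ampl_inj f g : ampl f = ampl g -> f = g.
Proof. by move=> /(congr1 compress); rewrite !amplK. Qed.

Lemma amplP (s : R[i]) f g : ampl (s *: f + g) = s *: ampl f + ampl g.
Proof.
by apply/funext => x; rewrite /ampl -[RHS]/(s *: inject i0 _ + inject i0 _) -injectP.
Qed.

Lemma amplD f g : ampl (f + g) = ampl f + ampl g.
Proof. by have := amplP 1 f g; rewrite !scale1r. Qed.

Lemma ampl0 : ampl 0 = 0.
Proof.
apply/funext => x; apply: coord_eq => k; rewrite /ampl coord_inject.
by rewrite /coord ffunE; case: ifP.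
Qed.

Lemma amplM f g : ampl (f \o g) = ampl f \o ampl g.
Proof. by apply/funext => x; rewrite /ampl /= coord_inject eqxx. Qed.

Lemma ampl_adjoint f g : is_adjoint f g -> is_adjoint (ampl f) (ampl g).
Proof. by move=> fg x y; rewrite /ampl hdot_inject_l hdot_inject_r fg. Qed.

Lemma compress_adjoint f g : is_adjoint f g -> is_adjoint (compress f) (compress g).
Proof.
by move=> fg x y; rewrite /compress !matrix_entryE -hdot_inject_r fg hdot_inject_l.
Qed.

Lemma bounded_ampl f : bounded_operator f -> bounded_operator (ampl f).
Proof.
move=> [lf [k kf]]; split=> [s x y|]; first by rewrite /ampl coordP lf injectP.
exists `|k| => x; rewrite /ampl hnorm_inject; apply: le_trans (kf _) _.
apply: (@le_trans _ _ (`|k| * hnorm (coord x i0))).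
  by rewrite ler_wpM2r ?hnorm_ge0 ?ler_norm.
by rewrite ler_wpM2l// hnorm_coord.
Qed.

Lemma adjoint_unique (L : hilbertSpace R) (f g h : L -> L) :
  is_adjoint f g -> is_adjoint f h -> g = h.
Proof.
move=> fg fh; apply/funext => y; apply: hdot_inj => z.
by rewrite hdotC -fg fh -hdotC.
Qed.

Lemma hdot_ampl f x y : hdot (ampl f x) y = hdot (f (coord x i0)) (coord y i0).
Proof. by rewrite /ampl hdot_inject_l. Qed.

Lemma ampl_preimage_vna (B : set (K -> K)) : von_neumann_algebra B ->
  von_neumann_algebra [set f | bounded_operator f /\ B (ampl f)].
Proof.
move=> vnB; split.
- by move=> f [].
- by split; [exact: bounded_zero|rewrite ampl0; exact: (vna_zero vnB)].
- move=> s f g [bf Bf] [bg Bg]; split; first exact: bounded_lin.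
  by rewrite amplP; exact: (vna_linear vnB).
- move=> f g [bf Bf] [bg Bg]; split; first exact: bounded_comp.
  by rewrite amplM; exact: (vna_mul vnB).
- move=> f [bf Bf]; have [g Bg fg] := vna_adjoint vnB Bf.
  (* By uniqueness of adjoints [g = ampl (compress g)], so the adjoint stays in the preimage. *)
  have fg' : is_adjoint f (compress g) by rewrite -[f]amplK; exact: compress_adjoint.
  exists (compress g) => //; split; first by apply/bounded_entry/(vna_bounded vnB).
  by rewrite (adjoint_unique (ampl_adjoint fg') fg).
- move=> f [bf cf]; split=> //; apply: (vna_closed vnB); split=> [|s e e0]; first exact: bounded_ampl.
  have [g [bg Bg] gs] := cf [seq (coord z.1 i0, coord z.2 i0) | z <- s] e e0.
  exists (ampl g) => // x y xy.
  have := gs _ _ (map_f (fun z => (coord z.1 i0, coord z.2 i0)) xy).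
  by congr (`|_| < _); rewrite /= !hdotBl !hdot_ampl.
Qed.

Lemma ampl_image_vna (A : set (H -> H)) : von_neumann_algebra A ->
  von_neumann_algebra [set ampl f | f in A].
Proof.
move=> vnA; split.
- by move=> _ [f Af <-]; exact/bounded_ampl/(vna_bounded vnA).
- by exists 0; [exact: (vna_zero vnA)|exact: ampl0].
- by move=> s _ _ [f Af <-] [g Ag <-]; exists (s *: f + g); [exact: (vna_linear vnA)|exact: amplP].
- by move=> _ _ [f Af <-] [g Ag <-]; exists (f \o g); [exact: (vna_mul vnA)|exact: amplM].
- move=> _ [f Af <-]; have [g Ag fg] := vna_adjoint vnA Af.
  by exists (ampl g); [exists g|exact: ampl_adjoint].
- move=> g [bg cg]; exists (compress g).
    apply: (vna_closed vnA); split=> [|s e e0]; first exact: bounded_entry.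
    have [_ [f Af <-] fs] := cg [seq (inject i0 z.1, inject i0 z.2) | z <- s] e e0.
    exists f => // x y xy; have := fs _ _ (map_f (fun z => (inject i0 z.1, inject i0 z.2)) xy).
    congr (`|_| < _); rewrite /= !hdotBl hdot_ampl !coord_inject eqxx; congr (_ - _).
    by rewrite hdot_inject_r.
  apply/funext => x; apply: hdot_inj => y; apply/eqP; rewrite -subr_eq0; apply/eqP.
  apply: complex_norm_eps_eq0 => d d0; have d20 : 0 < d / 2 by rewrite divr_gt0.
  pose x' := inject i0 (coord x i0); pose y' := inject i0 (coord y i0).
  (* As in [corner_vna], [ampl f] has the same coefficient at both pairs, which forces [g] to agree
     with [ampl (compress g)]. *)
  have [_ [f Af <-] fs] := cg [:: (x, y); (x', y')] _ d20.
  have := fs x y; rewrite !in_cons eqxx => /(_ isT) h1.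
  have := fs x' y'; rewrite !in_cons eqxx orbT => /(_ isT) h2.
  have -> : hdot (ampl (compress g) x) y - hdot (g x) y =
      hdot ((g - ampl f) x') y' - hdot ((g - ampl f) x) y.
    rewrite hdot_ampl -hdot_inject_r -/y' !hdotBl !hdot_ampl !coord_inject eqxx.
    by rewrite opprB addrA subrK.
  apply: le_trans (ler_normB _ _) _; rewrite [d]splitr rmorphD.
  by apply/lerD; exact: ltW.
Qed.

Section Compression.
Variables (M : set (H -> H)) (tau : (H -> H) -> R[i]).
Hypotheses (vnM : von_neumann_algebra M) (M1 : M idfun) (trM : normal_trace M tau).

Let e : op K := unit_mx i0 i0 1.
Let L : set (K -> K) := matrix_algebra M.
Let vnL : von_neumann_algebra L := matrix_algebra_vna n vnM.
Let taue (g : K -> K) := matrix_trace tau g / matrix_trace tau e.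

Lemma unit_mx_ampl (x : op H) : op_fun (unit_mx i0 i0 x) = ampl x.
Proof.
apply/funext => y; apply: coord_eq => i; rewrite coord_op /ampl coord_inject.
rewrite (bigD1 i0) // ent_unit_mx eqxx andbT big1 => [|j /negbTE ji]; last first.
  by rewrite ent_unit_mx ji andbF.
by rewrite /= addr0; case: ifP.
Qed.

Lemma matrix_unit_in : L e.
Proof.
apply/(matrix_algebra_op vnM) => i j; rewrite ent_unit_mx.
by case: ifP => _; [exact: M1|exact: vna0].
Qed.

Lemma matrix_unit_projection : projection e.
Proof. by apply: projection_unit_mx; exact: projection1. Qed.

Lemma matrix_unit_trace : matrix_trace tau e = (n%:R^-1)%:C.
Proof.
rewrite (unit_mx_trace vnM trM) (trace_unit trM) mulr1.
by rewrite fmorphV rmorph_nat.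
Qed.

Lemma corner_ampl (g : K -> K) : corner L e g <-> exists2 f, M f & ampl f = g.
Proof.
have eE : op_fun e = ampl idfun by exact: unit_mx_ampl.
split=> [[h Lh <-]|[f Mf <-]].
  have [a ah] := matrix_algebra_ex vnM Lh; rewrite -ah in Lh *.
  exists (ent a i0 i0); first exact: (matrix_algebra_op vnM a).1.
  by rewrite eE.
have [b bf] := vna_op vnM Mf; exists (ampl f).
  rewrite -bf -unit_mx_ampl; apply/(matrix_algebra_op vnM) => i j; rewrite ent_unit_mx.
  by case: ifP => _; [rewrite bf|exact: vna0].
by rewrite eE -!amplM.
Qed.

Lemma taue_ampl f : M f -> complex.Re (taue (ampl f)) = complex.Re (tau f).
Proof.
move=> /(vna_op vnM)[b <-]; rewrite /taue -unit_mx_ampl (unit_mx_trace vnM trM).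
have n0 : n%:R != 0 :> R[i] by rewrite pnatr_eq0 -lt0n (leq_ltn_trans _ (ltn_ord i0)).
by rewrite matrix_unit_trace fmorphV rmorph_nat mulrAC mulfV ?invr_eq0// mul1r.
Qed.

(** [ampl] and [compress] give the two inequalities: a von Neumann algebra on [K] is brought to [H]
    as a preimage under [ampl], and one on [H] is brought to [K] as an image. *)
Lemma calG_compression : calG (corner L e) e taue = calG M idfun tau.
Proof.
have vnC := corner_vna vnL matrix_unit_in matrix_unit_projection.
have eE : op_fun e = ampl idfun by exact: unit_mx_ampl.
have cM f : M f -> corner L e (ampl f) by move=> Mf; apply/corner_ampl; exists f.
apply/le_anti/andP; split.
  apply: (@calG_transfer _ _ _ M (corner L e) idfun e tau taue ampl) => //.
  - by move=> g /corner_ampl.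
  - by move=> f g _ _; exact: ampl_inj.
  - exact: ampl0.
  - exact: amplD.
  - by move=> f g _ _; exact: amplM.
  - by move=> f _; exact: ampl_adjoint.
  - exact: taue_ampl.
  - move=> B vnB; exists [set f | bounded_operator f /\ B (ampl f)].
      exact: ampl_preimage_vna.
    by move=> f Mf; split=> [[_ ?]|?] //; split=> //; exact: (vna_bounded vnM).
apply: (@calG_transfer _ _ _ (corner L e) M e idfun taue tau compress) => //.
- by move=> _ /corner_ampl[f Mf <-]; rewrite amplK.
- by move=> f Mf; exists (ampl f); [exact: cM|exact: amplK].
- by move=> _ _ /corner_ampl[f Mf <-] /corner_ampl[g Mg <-]; rewrite !amplK => ->.
- by rewrite -ampl0 amplK.
- by move=> f g; apply/funext => y; rewrite /compress !matrix_entryE /coord ffunE.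
- by move=> _ _ /corner_ampl[f Mf <-] /corner_ampl[g Mg <-]; rewrite -amplM !amplK.
- by move=> f _; exact: compress_adjoint.
- by rewrite eE amplK.
- by move=> _ /corner_ampl[f Mf <-]; rewrite amplK taue_ampl.
- move=> B vnB; exists [set ampl f | f in B]; first exact: ampl_image_vna.
  move=> _ /corner_ampl[f Mf <-]; rewrite amplK; split; last by exists f.
  by move=> [g Bg /ampl_inj <-].
Qed.

End Compression.
End CornerOfMatrixAlgebra.

Theorem theorem4p5 (R : realType) (H : hilbertSpace R) (M : set (H -> H))
    (tau : (H -> H) -> R[i])
    (M_factor : II1_factor M) (tau_trace : normal_trace M tau)
    (M_separable : trace_separable M tau)
    (t : R) (t_gt0 : 0 < t) (n : nat) (n_gt : t < n%:R)
    (p : hilbert_power H n -> hilbert_power H n)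
    (p_in : matrix_algebra M p) (p_proj : is_projection p)
    (p_trace : matrix_trace tau p = (t / n%:R)%:C) :
  calG (corner (matrix_algebra M) p) p (corner_trace tau p) =
  ((t ^- 2)%:E * calG M idfun tau)%E.
Proof.
have [factM _ nominM] := M_factor; have [vnM M1 id0 _] := factM.
have n0 : (0 < n)%N by rewrite -(ltr0n R); exact: lt_trans n_gt.
have n0' : 0 < n%:R :> R by rewrite ltr0n.
pose i0 := Ordinal n0.
have trM := normal_trace_finite vnM tau_trace.
have vnL := matrix_algebra_vna n vnM.
have L1 := matrix_algebra_one n vnM M1.
have trL := matrix_trace_finite vnM tau_trace n0.
have primeL := matrix_algebra_prime (n := n) vnM (factor_prime vnM M1 trM factM).
have smallL := matrix_small_projections vnM tau_trace n0 i0 (small_projections vnM M1 trM id0 nominM).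
have [a ap] := matrix_algebra_ex vnM p_in; rewrite -ap in p_in p_proj p_trace *.
have {}p_proj : projection a by exact/projectionP.
(* [M] becomes the corner at a diagonal matrix unit, whose trace is [1 / n] against [t / n] for
   [p]. *)
rewrite -(calG_compression i0 vnM M1 tau_trace).
have Le := matrix_unit_in i0 vnM M1; have pe := matrix_unit_projection H i0.
have tre := matrix_unit_trace i0 vnM tau_trace.
have e0 : 0 < n%:R^-1 :> R by rewrite invr_gt0.
have p0 : 0 < t / n%:R by rewrite divr_gt0.
have h1 := corner_calG_le vnL L1 trL primeL smallL Le p_in pe p_proj tre p_trace e0 p0.
have h2 := corner_calG_le vnL L1 trL primeL smallL p_in Le p_proj pe p_trace tre p0 e0.
(* The ratio of the traces is [t^-1] one way and [t] the other, so the two instances bound each side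
   by the other. *)
have t1 : n%:R^-1 / (t / n%:R) = t^-1 by field; rewrite !gt_eqF.
have t2 : t / n%:R / n%:R^-1 = t by field; rewrite !gt_eqF.
rewrite t1 exprVn in h1; rewrite t2 in h2.
apply/le_anti/andP; split; first exact: h1.
by rewrite lee_pdivrMl ?exprn_gt0.
Qed.
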